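(* Let $m$ be an integer greater than $1$, and let $k_1,k_2$ be positive integers such that $w:=k_1+k_2$ is odd. Then the following equalities hold in $\mathcal{A}$: $$\pounds_{\mathcal{A},\{1\}^m}(2)=\widetilde{\pounds}^{\star}_{\mathcal{A},\{1\}^m}(2)=\frac{1-2^{m-1}}{2^{m-2}}\frac{B_{\mathbf{p}-m}}{m},$$ $$\widetilde{\pounds}_{\mathcal{A},\{1\}^m}(1/2)=\pounds^{\star}_{\mathcal{A},\{1\}^m}(1/2)=\frac{2^{m-1}-1}{2^{m-1}}\frac{B_{\mathbf{p}-m}}{m},$$ $$\pounds_{\mathcal{A},(\{1\}^{k_1-1},2,\{1\}^{k_2-1})}(2)=\left\{\frac{2^{w-1}-1}{2^{w-1}}-(-1)^{k_1}\binom{w}{k_1}\right\}\frac{B_{\mathbf{p}-w}}{w},$$ $$\widetilde{\pounds}^{\star}_{\mathcal{A},(\{1\}^{k_1-1},2,\{1\}^{k_2-1})}(2)=\left\{\frac{1-2^{w-1}}{2^{w-1}}-(-1)^{k_1}\binom{w}{k_1}\right\}\frac{B_{\mathbf{p}-w}}{w},$$ $$\widetilde{\pounds}_{\mathcal{A},(\{1\}^{k_1-1},2,\{1\}^{k_2-1})}(1/2)=\frac12\left\{\frac{1-2^{w-1}}{2^{w-1}}-(-1)^{k_1}\binom{w}{k_1}\right\}\frac{B_{\mathbf{p}-w}}{w},$$ $$\pounds^{\star}_{\mathcal{A},(\{1\}^{k_1-1},2,\{1\}^{k_2-1})}(1/2)=\frac12\left\{\frac{2^{w-1}-1}{2^{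w-1}}-(-1)^{k_1}\binom{w}{k_1}\right\}\frac{B_{\mathbf{p}-w}}{w}.$$
   Context: $\mathcal{A}=\left(\prod_p\mathbb{F}_p\right)/\left(\bigoplus_p\mathbb{F}_p\right)$, $p$ running over all primes. Elements are written $(a_p)_p$; two are equal iff their components agree for all but finitely many $p$ (so components may be undefined for finitely many $p$). $B_{\mathbf{p}-k}=(B_{p-k}\bmod p)_p$, with $B_n$ the Bernoulli numbers, $\frac{te^t}{e^t-1}=\sum_nB_n\frac{t^n}{n!}$. $\{1\}^r$ denotes $1$ repeated $r$ times. For a tuple of positive integers $\mathbf{k}=(k_1,\dots,k_m)$ and a rational number $r\ne0$: $\pounds_{\mathcal{A},\mathbf{k}}(r)=\bigl(\sum_{p>n_1>\cdots>n_m>0}\frac{r^{n_1}}{n_1^{k_1}\cdots n_m^{k_m}}\bmod p\bigr)_p$, $\widetilde{\pounds}_{\mathcal{A},\mathbf{k}}(r)=\bigl(\sum_{p>n_1>\cdots>n_m>0}\frac{r^{n_m}}{n_1^{k_1}\cdots n_m^{k_m}}\bmod p\bigr)_p$, and $\pounds^{\star}_{\mathcal{A},\mathbf{k}}(r)$, $\widetilde{\pounds}^{\star}_{\mathcal{A},\mathbf{k}}(r)$ are defined by the same summands with the summation range replaced by $p-1\ge n_1\ge\cdots\ge n_m\ge1$. *)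

(* Defs.v *)
From HB Require Import structures.
From mathcomp Require Import all_boot all_order all_algebra.
From mathcomp Require Import boolp classical_sets functions cardinality.
From mathcomp Require Import zify ring.

Set Implicit Arguments.
Unset Strict Implicit.
Unset Printing Implicit Defensive.

Import Order.TTheory GRing.Theory Num.Theory.
Local Open Scope classical_set_scope.
Local Open Scope ring_scope.
Local Open Scope quotient_scope.

Definition primeT := {p : nat | prime p}.

Definition prodFp := forall p : primeT, 'F_(val p).

HB.instance Definition _ := gen_eqMixin prodFp.
HB.instance Definition _ := gen_choiceMixin prodFp.

Definition prodFp_zero : prodFp := fun=> 0.
Definition prodFp_opp (f : prodFp) : prodFp := fun p => - f p.
Definition prodFp_add (f g : prodFp) : prodFp := fun p => f p + g p.
Definition prodFp_one : prodFp := fun=> 1.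
Definition prodFp_mul (f g : prodFp) : prodFp := fun p => f p * g p.

Lemma prodFpP (f g : prodFp) : (forall p, f p = g p) -> f = g.
Proof. exact: functional_extensionality_dep. Qed.

Lemma prodFp_addA : associative prodFp_add.
Proof. by move=> f g h; apply: prodFpP => p; exact: addrA. Qed.
Lemma prodFp_addC : commutative prodFp_add.
Proof. by move=> f g; apply: prodFpP => p; exact: addrC. Qed.
Lemma prodFp_add0 : left_id prodFp_zero prodFp_add.
Proof. by move=> f; apply: prodFpP => p; exact: add0r. Qed.
Lemma prodFp_addN : left_inverse prodFp_zero prodFp_opp prodFp_add.
Proof. by move=> f; apply: prodFpP => p; exact: addNr. Qed.

HB.instance Definition _ := GRing.isZmodule.Build prodFp
  prodFp_addA prodFp_addC prodFp_add0 prodFp_addN.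

Lemma prodFp_mulA : associative prodFp_mul.
Proof. by move=> f g h; apply: prodFpP => p; exact: mulrA. Qed.
Lemma prodFp_mulC : commutative prodFp_mul.
Proof. by move=> f g; apply: prodFpP => p; exact: mulrC. Qed.
Lemma prodFp_mul1 : left_id prodFp_one prodFp_mul.
Proof. by move=> f; apply: prodFpP => p; exact: mul1r. Qed.
Lemma prodFp_mulDl : left_distributive prodFp_mul +%R.
Proof. by move=> f g h; apply: prodFpP => p; exact: mulrDl. Qed.
Lemma prodFp_one_neq0 : prodFp_one != 0.
Proof.
apply/eqP => /(congr1 (fun f : prodFp => f (exist _ 2 (isT : prime 2)))).
by move/eqP; rewrite (oner_eq0 'F_2).
Qed.

HB.instance Definition _ := GRing.Zmodule_isComNzRing.Build prodFp
  prodFp_mulA prodFp_mulC prodFp_mul1 prodFp_mulDl prodFp_one_neq0.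

Lemma prodFpE (p : primeT) :
  ((0 : prodFp) p = 0) * ((1 : prodFp) p = 1) *
  (forall f : prodFp, (- f) p = - f p) *
  (forall f g : prodFp, (f + g) p = f p + g p) *
  (forall f g : prodFp, (f * g) p = f p * g p).
Proof. by []. Qed.

Definition dirsumFp : {pred prodFp} :=
  fun f => `[< finite_set [set p | f p != 0] >].

Lemma finite_primeTP (P : primeT -> Prop) :
  finite_set [set p | P p] <-> exists N, forall p, P p -> (val p < N)%N.
Proof.
split=> [/finite_seqP[s Ps] | [N PN]].
  exists (\max_(p <- s) val p).+1 => p Pp; rewrite ltnS.
  apply: (leq_bigmax_seq p) => //.
  by have : [set p | P p] p by []; rewrite Ps.
apply: (@sub_finite_set _ _ ((fun p : primeT => val p) @^-1` `I_N)) => //.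
by apply: finite_preimage => // p q _ _ /val_inj.
Qed.

Lemma dirsumFpP (f : prodFp) :
  reflect (exists N, forall p, (N <= val p)%N -> f p = 0) (f \in dirsumFp).
Proof.
apply: (iffP (asboolP _)) => [/finite_primeTP[N fN] | [N fN]].
  exists N => p; apply: contraTeq => /fN; by rewrite ltnNge.
apply/finite_primeTP; exists N => p; apply: contraNT.
by rewrite -leqNgt => /fN->.
Qed.

Lemma exists_primeT N : exists p : primeT, (N <= val p)%N.
Proof.
have [p Np pp] := prime_above N.
by exists (exist _ p pp); exact: ltnW.
Qed.

Lemma dirsumFp_idealr : idealr_closed dirsumFp.
Proof.
split=> [||a f g /dirsumFpP[N fN] /dirsumFpP[M gM]].
- by apply/dirsumFpP; exists 0.
- apply/dirsumFpP => -[N N1]; have [p Np] := exists_primeT N.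
  by have /eqP := N1 p Np; rewrite (oner_eq0 'F_(val p)).
- apply/dirsumFpP; exists (maxn N M) => p; rewrite geq_max => /andP[Np Mp].
  by rewrite !prodFpE fN // gM // mulr0 addr0.
Qed.

HB.instance Definition _ := isIdealr.Build prodFp dirsumFp dirsumFp_idealr.

Definition ringA := {ideal_quot (dirsumFp : idealr prodFp)}.

HB.instance Definition _ := GRing.ComNzRing.on ringA.

(* The class (a_p)_p.  A component that is undefined in the source is given
   here by the conventions on inverses in 'F_p and on subtraction in nat; this
   concerns only finitely many p, hence not the class. *)
Definition classA (f : prodFp) : ringA := \pi_ringA f.

Lemma classA_surj (x : ringA) : exists f, x = classA f.
Proof. by exists (repr x); rewrite /classA reprK. Qed.

Lemma classAP (f g : prodFp) :
  classA f = classA g <-> exists N, forall p, (N <= val p)%N -> f p = g p.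
Proof.
have -> : classA f = classA g <-> f - g \in dirsumFp.
  by rewrite Quotient.idealrBE; split=> [/eqP|/eqP].
split=> [/dirsumFpP[N fgN] | [N fgN]].
  by exists N => p /fgN/eqP; rewrite !prodFpE subr_eq0 => /eqP.
by apply/dirsumFpP; exists N => p /fgN fg; rewrite !prodFpE fg subrr.
Qed.

Lemma classAD (f g : prodFp) : classA f + classA g = classA (fun p => f p + g p).
Proof. by rewrite /classA -[RHS]/(\pi_ringA (f + g)) !piE. Qed.

Lemma classAM (f g : prodFp) : classA f * classA g = classA (fun p => f p * g p).
Proof. by rewrite /classA -[RHS]/(\pi_ringA (f * g)) !piE. Qed.

Lemma classA1 : 1 = classA (fun p => 1).
Proof. by rewrite /classA -[RHS]/(\pi_ringA 1) !piE. Qed.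

Definition ratA (q : rat) : ringA := classA (fun p => ratr q).

Lemma Fp_intr_neq0 (z : int) (p : primeT) :
  z != 0 -> (`|z| < val p)%N -> z%:~R != 0 :> 'F_(val p).
Proof.
have chFp := pchar_Fp (valP p).
case: z => n z0 lt_n; rewrite ?NegzE ?mulrNz ?oppr_eq0 -[_%:~R]/(_%:R).
  by rewrite -(dvdn_pcharf chFp) gtnNdvd // lt0n.
by rewrite -(dvdn_pcharf chFp) gtnNdvd.
Qed.

Lemma ratr_Fp_unique (q : rat) (p : primeT) (a b : int) :
    (`|denq q| < val p)%N -> (b%:~R : 'F_(val p)) != 0 -> q * b%:~R = a%:~R ->
  ratr q = a%:~R / b%:~R :> 'F_(val p).
Proof.
move=> dq_lt b0 qba; rewrite /ratr.
have dq0 := Fp_intr_neq0 (denq_neq0 q) dq_lt.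
apply/eqP; rewrite eqr_div // -!rmorphM /=; apply/eqP; congr (_%:~R).
apply: (@intr_inj rat); rewrite !rmorphM /= -qba.
by rewrite mulrAC numqE.
Qed.

Lemma ratA_add (q1 q2 : rat) : ratA (q1 + q2) = ratA q1 + ratA q2.
Proof.
rewrite classAD; apply/classAP.
exists (`|denq q1| + `|denq q2| + `|denq (q1 + q2)|).+1%N => p lt_p.
have d1 : (denq q1)%:~R != 0 :> 'F_(val p).
  by apply: Fp_intr_neq0 => //; lia.
have d2 : (denq q2)%:~R != 0 :> 'F_(val p).
  by apply: Fp_intr_neq0 => //; lia.
rewrite (@ratr_Fp_unique _ _ (numq q1 * denq q2 + numq q2 * denq q1)
  (denq q1 * denq q2)).
- by rewrite /ratr rmorphD !rmorphM /= addf_div.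
- lia.
- by rewrite rmorphM mulf_neq0.
- by rewrite rmorphD !rmorphM /= !numqE mulrDl; ring.
Qed.

Lemma ratA_mul (q1 q2 : rat) : ratA (q1 * q2) = ratA q1 * ratA q2.
Proof.
rewrite classAM; apply/classAP.
exists (`|denq q1| + `|denq q2| + `|denq (q1 * q2)|).+1%N => p lt_p.
have d1 : (denq q1)%:~R != 0 :> 'F_(val p).
  by apply: Fp_intr_neq0 => //; lia.
have d2 : (denq q2)%:~R != 0 :> 'F_(val p).
  by apply: Fp_intr_neq0 => //; lia.
rewrite (@ratr_Fp_unique _ _ (numq q1 * numq q2) (denq q1 * denq q2)).
- by rewrite /ratr !rmorphM /= mulf_div.
- lia.
- by rewrite rmorphM mulf_neq0.
- by rewrite !rmorphM /= !numqE; ring.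
Qed.

Lemma ratA1 : ratA 1 = 1.
Proof.
by rewrite classA1; congr classA; apply: prodFpP => p; exact: (ratr_nat _ 1).
Qed.

Definition scaleA (q : rat) (x : ringA) : ringA := ratA q * x.

Lemma scaleA_A (a b : rat) (x : ringA) :
  scaleA a (scaleA b x) = scaleA (a * b) x.
Proof. by rewrite /scaleA ratA_mul mulrA. Qed.
Lemma scaleA_1 : left_id 1 scaleA.
Proof. by move=> x; rewrite /scaleA ratA1 mul1r. Qed.
Lemma scaleA_Dr : right_distributive scaleA +%R.
Proof. by move=> a x y; rewrite /scaleA mulrDr. Qed.
Lemma scaleA_Dl (x : ringA) : {morph scaleA^~ x : a b / a + b}.
Proof. by move=> a b; rewrite /scaleA ratA_add mulrDl. Qed.

HB.instance Definition _ := GRing.Zmodule_isLmodule.Build rat ringA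
  scaleA_A scaleA_1 scaleA_Dr scaleA_Dl.

Lemma classAZ (q : rat) (f : prodFp) :
  q *: classA f = classA (fun p => ratr q * f p).
Proof. exact: classAM. Qed.

(* The list of c_i = B_i / i! for i < n, obtained by dividing e^t by
   (e^t - 1) / t:  c_n = 1 / n! - \sum_(i < n) c_i / (n + 1 - i)!. *)
Fixpoint bernoulli_seq (n : nat) : seq rat :=
  if n is n'.+1 then
    let c := bernoulli_seq n' in
    rcons c (n'`!%:R^-1 - \sum_(i < n') c`_i / (n'.+1 - i)`!%:R)
  else [::].

Definition bernoulli (n : nat) : rat := n`!%:R * (bernoulli_seq n.+1)`_n.

(* Coefficients of the power series t e^t and e^t - 1. *)
Definition coef_texp (n : nat) : rat := if n is n'.+1 then n'`!%:R^-1 else 0.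
Definition coef_expB1 (n : nat) : rat := if n is 0 then 0 else n`!%:R^-1.

Lemma size_bernoulli_seq (n : nat) : size (bernoulli_seq n) = n.
Proof. by elim: n => //= n IHn; rewrite size_rcons IHn. Qed.

Lemma nth_bernoulli_seq (n i : nat) :
  (i < n)%N -> (bernoulli_seq n)`_i = bernoulli i / i`!%:R.
Proof.
have f0 k : (k`!%:R : rat) != 0 by rewrite pnatr_eq0 -lt0n fact_gt0.
rewrite /bernoulli mulrC mulKf //.
elim: n => // n IHn; rewrite ltnS leq_eqVlt => /predU1P[-> // | lt_in].
by rewrite -IHn //= nth_rcons size_bernoulli_seq lt_in.
Qed.

Lemma bernoulli_genfun (n : nat) :
  \sum_(i < n.+1) bernoulli i / i`!%:R * coef_expB1 (n - i) = coef_texp n.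
Proof.
rewrite big_ord_recr /= subnn mulr0 addr0; case: n => [|n]; first by rewrite big_ord0.
rewrite big_ord_recr /= subSnn divr1.
rewrite -(@nth_bernoulli_seq n.+1) //= nth_rcons size_bernoulli_seq ltnn eqxx.
rewrite addrC -addrA [X in _ + X]addrC -sumrB big1 ?addr0 // => i _.
by rewrite nth_bernoulli_seq // subSn ?(ltnW (ltn_ord i)) // subrr.
Qed.

Definition bernoulliA (k : nat) : ringA :=
  classA (fun p => ratr (bernoulli (val p - k))).

(* The sum of r ^ (e (n_1, ..., n_m)) / (n_1 ^ k_1 ... n_m ^ k_m) modulo p over
   all 0 < n_1, ..., n_m < p such that n_i and n_(i+1) are related by R. *)
Definition mpl_mod (R : rel nat) (e : seq nat -> nat) (k : seq nat) (r : rat)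
    (p : nat) : 'F_p :=
  \sum_(n : (size k).-tuple 'I_p | sorted R [seq val i | i <- n]
                                   && all (ltn 0) [seq val i | i <- n])
    ratr r ^+ e [seq val i | i <- n]
      / \prod_(j < size k) (val (tnth n j))%:R ^+ nth 0%N k j.

Definition mplA (k : seq nat) (r : rat) : ringA :=
  classA (fun p => mpl_mod gtn (head 0%N) k r (val p)).
Definition tmplA (k : seq nat) (r : rat) : ringA :=
  classA (fun p => mpl_mod gtn (last 0%N) k r (val p)).
Definition mplA_star (k : seq nat) (r : rat) : ringA :=
  classA (fun p => mpl_mod geq (head 0%N) k r (val p)).
Definition tmplA_star (k : seq nat) (r : rat) : ringA :=
  classA (fun p => mpl_mod geq (last 0%N) k r (val p)).

(* ({1}^(k1-1), 2, {1}^(k2-1)) *)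
Definition ones2 (k1 k2 : nat) : seq nat := nseq k1.-1 1%N ++ 2%N :: nseq k2.-1 1%N.

(* Main.v *)
Require Import Defs.
From mathcomp Require Import all_boot all_order all_algebra.
From mathcomp Require Import finfield zify ring.

Set Implicit Arguments.
Unset Strict Implicit.
Unset Printing Implicit Defensive.

Import Order.TTheory GRing.Theory Num.Theory.
Local Open Scope ring_scope.

(** Everything is proved modulo a fixed large odd prime p, where n |-> p - n
reverses the order of summation and 1 / n ^ k is the power n ^ (p - 1 - k).

Two symmetries reduce the six sums to the two non-star sums at 2 whose
variable sits on the largest index.  The reflection n |-> p - n, together with
t ^ p = t, exchanges t with 1 / t and the largest with the smallest index, so
the values at 1/2 follow from those at 2 for the reversed index
([reflect_last], [reflect_head_star]).  The antipode relation between strict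
and weak nested sums ([nsum_antipode]) expresses the star sums through the
non-star ones; the products that it brings in vanish ([Llast_star_antipode]),
because the harmonic sums of index 1, ..., 1 do and, for odd w, every other
product has a factor of even weight, which vanishes by parity.

The two remaining sums are values of polynomials in the variable t over the
prime field.  Differentiating lowers the first index, and t |-> 1 - t exchanges
the operators t d/dt and (1 - t) d/dt up to sign.  By induction, the sum over
1, ..., 1 (m times) at t is, up to sign, the single sum of (1 - t) ^ n / n ^ m
([Li_ones]), and the sum over 1, ..., 1, 2, 1, ..., 1 is, up to sign, the double
sum for (k1, k2) at 1 - t plus a combination of single sums
([Li_ones2_duality]).  At t = 0 the latter gives the duality between the sums at
1 of the index 1, ..., 1, 2, 1, ..., 1 and of (k1, k2).  At t = 2 one has
1 - t = -1; there parity kills all the cross terms for odd w, and reflection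
with the stuffle product reduces the alternating double sum to a single one
([alternating_hsum2]).

It remains to evaluate the sum of (-1) ^ n / n ^ m and the double sum for
(k1, k2) at 1.  As sums of powers they are read off from exponential
generating series truncated at degree p, where the Bernoulli numbers of index
at most p - 2 are p-integral: the first from
2 t e^t / (e^t - 1) - 4 t e^(2t) / (e^(2t) - 1) = - 2 t e^t / (e^t + 1)
([alternating_hsum]), the second from Faulhaber's formula ([hsum2]). *)

(** * Strict and weak nested sums *)

Section NestedSums.

Variable R : comNzRingType.
Implicit Types (f g : nat -> R) (fs gs : seq (nat -> R)) (N : nat).

Fixpoint nsum fs N : R :=
  if fs is f :: fs' then \sum_(n < N) f n * nsum fs' n else 1.

Fixpoint nsum_star fs N : R :=
  if fs is f :: fs' then \sum_(n < N) f n * nsum_star fs' n.+1 else 1.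

Lemma nsumS f fs N : nsum (f :: fs) N.+1 = nsum (f :: fs) N + f N * nsum fs N.
Proof. by rewrite /= big_ord_recr. Qed.

Lemma nsum_starS f fs N :
  nsum_star (f :: fs) N.+1 = nsum_star (f :: fs) N + f N * nsum_star fs N.+1.
Proof. by rewrite /= big_ord_recr. Qed.

Lemma nsum0 fs : nsum fs 0 = (nilp fs)%:R.
Proof. by case: fs => //= f fs; rewrite big_ord0. Qed.

Lemma nsum_star0 fs : nsum_star fs 0 = (nilp fs)%:R.
Proof. by case: fs => //= f fs; rewrite big_ord0. Qed.

Section Map.
Variables (T : Type) (F G : T -> nat -> R) (c : T -> R).

Lemma nsum_map_scale (s : seq T) N :
    (forall x n, (n < N)%N -> F x n = c x * G x n) ->
  nsum (map F s) N = (\prod_(x <- s) c x) * nsum (map G s) N.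
Proof.
elim: s N => [|x s IHs] N eqFG /=; first by rewrite big_nil mulr1.
rewrite big_cons mulr_sumr; apply: eq_bigr => n _.
rewrite eqFG // IHs; first by ring.
by move=> y m lt_mn; rewrite eqFG //; apply: ltn_trans (ltn_ord n).
Qed.

Lemma nsum_star_map_scale (s : seq T) N :
    (forall x n, (n < N)%N -> F x n = c x * G x n) ->
  nsum_star (map F s) N = (\prod_(x <- s) c x) * nsum_star (map G s) N.
Proof.
elim: s N => [|x s IHs] N eqFG /=; first by rewrite big_nil mulr1.
rewrite big_cons mulr_sumr; apply: eq_bigr => n _.
rewrite eqFG // IHs; first by ring.
by move=> y m lt_mn; rewrite eqFG //; apply: leq_trans (ltn_ord n).
Qed.

End Map.

Definition shift f n := f n.+1.

(** Where [nsumS] splits according to whether the largest index is maximal, this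
splits according to whether the smallest index is 0; [nsum_rev_map] plays one
against the other. *)
Lemma nsum_rconsS fs f N :
  nsum (rcons fs f) N.+1
  = nsum (map shift (rcons fs f)) N + nsum (map shift fs) N * f 0%N.
Proof.
elim: fs N => [|g fs IHfs] N /=; first by rewrite big_ord_recl /= addrC !mulr1 mul1r.
rewrite big_ord_recl /= nsum0 /nilp size_rcons mulr0 add0r mulr_suml -big_split /=.
by apply: eq_bigr => n _; rewrite IHfs mulrDr mulrA.
Qed.

(** Here the other indices may also take the value 0, so they are not shifted. *)
Lemma nsum_star_rconsS fs f N :
  nsum_star (rcons fs f) N.+1
  = nsum_star (map shift (rcons fs f)) N + nsum_star fs N.+1 * f 0%N.
Proof.
elim: fs N => [|g fs IHfs] N /=; first by rewrite big_ord_recl /= addrC !mulr1 mul1r.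
under eq_bigr do rewrite IHfs mulrDr mulrA.
by rewrite big_split /= -mulr_suml big_ord_recl /= nsum_star0 /nilp size_map
  size_rcons mulr0 add0r.
Qed.

Lemma nsum_rev_map (T : Type) (F : T -> nat -> R) (s : seq T) N :
  nsum (map F (rev s)) N = nsum (map (fun x n => F x (N - n.+1)%N) s) N.
Proof.
elim: N s => [|N IHN] s; first by rewrite !nsum0 /nilp !size_map size_rev.
case/lastP: s => // s x; rewrite rev_rcons map_cons nsumS -map_cons -rev_rcons.
rewrite !IHN !map_rcons nsum_rconsS subn1 /= -!map_rcons -!map_comp mulrC.
by congr (_ + _).
Qed.

Lemma nsum_star_rev_map (T : Type) (F : T -> nat -> R) (s : seq T) N :
  nsum_star (map F (rev s)) N
  = nsum_star (map (fun x n => F x (N - n.+1)%N) s) N.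
Proof.
elim: N s => [|N IHN] s; first by rewrite !nsum_star0 /nilp !size_map size_rev.
elim/last_ind: s => // s x IHs; rewrite rev_rcons map_cons nsum_starS.
rewrite -map_cons -rev_rcons IHN IHs !map_rcons nsum_star_rconsS subn1 /= mulrC.
by rewrite map_rcons -map_comp.
Qed.

Lemma nsum_shift (T : eqType) (F : T -> nat -> R) (s : seq T) N :
    (0 < N)%N -> (forall x, x \in s -> F x 0%N = 0) ->
  nsum (map F s) N = nsum (map (fun x => shift (F x)) s) N.-1.
Proof.
case: N => // N _; elim: s N => //= x s IHs N F0.
rewrite big_ord_recl F0 ?mul0r ?add0r ?mem_head //.
by apply: eq_bigr => n _; rewrite IHs // => y sy; rewrite F0 // inE sy orbT.
Qed.

Lemma nsum_star_shift (T : eqType) (F : T -> nat -> R) (s : seq T) N :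
    (0 < N)%N -> (forall x, x \in s -> F x 0%N = 0) ->
  nsum_star (map F s) N = nsum_star (map (fun x => shift (F x)) s) N.-1.
Proof.
case: N => // N _; elim: s N => //= x s IHs N F0.
rewrite big_ord_recl F0 ?mul0r ?add0r ?mem_head //.
by apply: eq_bigr => n _; rewrite IHs // => y sy; rewrite F0 // inE sy orbT.
Qed.

(** With noncommuting letters, the strict sums with increasing indices are the
coefficients of the product of the 1 - f n in increasing order of n, and the
weak sums with decreasing indices those of the inverse product.  Passing from N
to N + 1 inserts (1 - f N) (1 - f N)^-1 in the middle, which changes nothing. *)
Lemma nsum_antipode fs N : (0 < size fs)%N ->
  \sum_(i < (size fs).+1)
     (-1) ^+ i * nsum (rev (take i fs)) N * nsum_star (drop i fs) N = 0.
Proof.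
move=> fs_gt0; elim: N => [|N IHN].
  rewrite big1 // => i _; rewrite nsum0 nsum_star0 /nilp size_rev size_drop.
  rewrite size_takel; last by rewrite -ltnS.
  case: eqP => [-> | _]; last by rewrite mulr0 mul0r.
  by rewrite subn0 (gtn_eqF fs_gt0) mulr0.
rewrite -[RHS]IHN; pose d := (\0 : nat -> R).
(* [A] and [B] split the strict factor according to whether N is the value of
   its largest index; shifting [B] by one pairs it with the weak factor. *)
pose A i := (-1) ^+ i * nsum (rev (take i fs)) N * nsum_star (drop i fs) N.+1.
pose B i := (-1) ^+ i * (nth d fs i N * nsum (rev (take i fs)) N)
              * nsum_star (drop i.+1 fs) N.+1.
transitivity (\sum_(i < (size fs).+1) A i - \sum_(i < size fs) B i).
  rewrite big_ord_recl [in RHS]big_ord_recl /= -addrA -sumrB.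
  congr (_ + _); first by rewrite /A take0.
  apply: eq_bigr => i _; rewrite /A /B /bump /= add1n.
  rewrite (take_nth d) // rev_rcons nsumS exprS; ring.
rewrite big_ord_recr [in RHS]big_ord_recr /= addrAC -sumrB.
congr (_ + _); last by rewrite /A drop_size.
by apply: eq_bigr => i _; rewrite /A /B (drop_nth d) // nsum_starS; ring.
Qed.

Lemma nsum_stuffle f g N :
  nsum [:: f; g] N + nsum [:: g; f] N + \sum_(n < N) f n * g n
  = (\sum_(n < N) f n) * (\sum_(n < N) g n).
Proof.
elim: N => [|N IHN]; first by rewrite /= !big_ord0 !addr0 mul0r.
rewrite !nsumS !big_ord_recr /= mulrDl !mulrDr -IHN /=.
under [X in f N * X]eq_bigr do rewrite mulr1.
under [X in g N * X]eq_bigr do rewrite mulr1.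
by ring.
Qed.

End NestedSums.

(** * Weights, reflection, and the sums modulo a prime *)

Section PathSums.

Variables (R : comNzRingType) (p : nat).
Implicit Types (r : rel nat) (fs : seq (nat -> R)) (N : nat).

(** The nested sum of a chain for [r] below a bound, with each index ranging over
the ordinals: it serves strict and weak chains alike. *)
Fixpoint path_sum r fs N : R :=
  if fs is f :: fs' then \sum_(n < p | r N n) f n * path_sum r fs' n else 1.

Lemma path_sum_tuple r fs N m : size fs = m ->
  \sum_(n : m.-tuple 'I_p | path r N [seq val i | i <- n])
     \prod_(j < m) nth (fun=> 0) fs j (val (tnth n j))
  = path_sum r fs N.
Proof.
move=> <- {m}; elim: fs N => [|f fs IHfs] N /=.
  rewrite (big_pred1 [tuple]) ?big_ord0 // => t.
  by rewrite [t]tuple0; apply/esym/eqP.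
under [RHS]eq_bigr do rewrite -IHfs mulr_sumr.
rewrite pair_big_dep /=.
pose h (t : 'I_p * (size fs).-tuple 'I_p) := [tuple of t.1 :: t.2].
rewrite (reindex h) /=; last first.
  exists (fun t => (thead t, [tuple of behead t])) => [[x t] _ | t _].
    by congr (_, _); apply/val_inj.
  by rewrite [RHS]tuple_eta.
apply: eq_bigr => -[x t] _; rewrite big_ord_recl /= [tnth _ ord0]/= ; congr (_ * _).
by apply: eq_bigr => j _; rewrite !(tnth_nth x) /= add0n.
Qed.

Lemma path_sum_gtn fs N : (N <= p)%N -> path_sum gtn fs N = nsum fs N.
Proof.
elim: fs N => //= f fs IHfs N leNp.
rewrite (big_ord_widen p (fun n => f n * nsum fs n)) //.
apply: eq_bigr => n ltnN; rewrite IHfs //.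
exact/ltnW.
Qed.

Lemma path_sum_geq fs N : (N < p)%N -> path_sum geq fs N = nsum_star fs N.+1.
Proof.
elim: fs N => //= f fs IHfs N ltNp.
rewrite (big_ord_widen p (fun n => f n * nsum_star fs n.+1)) //.
by apply: eq_big => n //; rewrite IHfs.
Qed.

End PathSums.

Section Weights.

Variable p : nat.
Hypothesis p_pr : prime p.
Implicit Types (x : nat * 'F_p) (s : seq (nat * 'F_p)).

(** For 0 < x.1 this vanishes at n = 0 as 0^-1 = 0 in a field, so positivity of
the indices need not be imposed in the sums. *)
Definition wt x n : 'F_p := x.2 ^+ n / n%:R ^+ x.1.

Lemma Fp_natr : p%:R = 0 :> 'F_p.
Proof. exact: pcharf0 (pchar_Fp p_pr). Qed.

Lemma Fp_natr_neq0 n : (0 < n < p)%N -> n%:R != 0 :> 'F_p.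
Proof.
move=> /andP[n_gt0 ltnp].
by rewrite -(dvdn_pcharf (pchar_Fp p_pr)) gtnNdvd.
Qed.

Lemma Fp_exp (t : 'F_p) : t ^+ p = t.
Proof. by rewrite -{2}(expf_card t) card_Fp. Qed.

Lemma wt0 x : (0 < x.1)%N -> wt x 0 = 0.
Proof. by case: x => -[|k] t //= _; rewrite /wt expr0n /= invr0 mulr0. Qed.

Lemma wt_reflect x n : (n < p)%N ->
  wt x (p - n) = (-1) ^+ x.1 * x.2 * wt (x.1, x.2^-1) n.
Proof.
move=> ltnp; rewrite /wt /= natrB ?Fp_natr ?sub0r; last exact: ltnW.
rewrite [in LHS]exprNn invfM invr_sign exprVn.
have [-> | t0] := eqVneq x.2 0.
  by rewrite expr0n subn_eq0 leqNgt ltnp mul0r mulr0 mul0r.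
suff -> : x.2 ^+ (p - n) = x.2 / x.2 ^+ n by rewrite -!mulrA [in RHS]mulrC; ring.
by rewrite expfB // Fp_exp.
Qed.

(** The index 0 contributes nothing, so the sums run over 1, ..., p - 1, a range
that n |-> p - n reverses. *)
Lemma nsum_reflect s : all (fun x => 0 < x.1)%N s ->
  nsum (map wt (rev s)) p
  = (\prod_(x <- s) ((-1) ^+ x.1 * x.2))
    * nsum (map wt (map (fun x => (x.1, x.2^-1)) s)) p.
Proof.
move=> /allP s_gt0; have p_gt0 := prime_gt0 p_pr.
rewrite -map_comp nsum_shift //; last by move=> x; rewrite mem_rev => /s_gt0; exact: wt0.
rewrite [in RHS]nsum_shift //; last by move=> x /s_gt0; exact: wt0.
rewrite nsum_rev_map; apply: nsum_map_scale => x n ltnq.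
by rewrite /shift -wt_reflect; [congr wt; lia | lia].
Qed.

Lemma nsum_star_reflect s : all (fun x => 0 < x.1)%N s ->
  nsum_star (map wt (rev s)) p
  = (\prod_(x <- s) ((-1) ^+ x.1 * x.2))
    * nsum_star (map wt (map (fun x => (x.1, x.2^-1)) s)) p.
Proof.
move=> /allP s_gt0; have p_gt0 := prime_gt0 p_pr.
rewrite -map_comp nsum_star_shift //; last by move=> x; rewrite mem_rev => /s_gt0; exact: wt0.
rewrite [in RHS]nsum_star_shift //; last by move=> x /s_gt0; exact: wt0.
rewrite nsum_star_rev_map; apply: nsum_star_map_scale => x n ltnq.
by rewrite /shift -wt_reflect; [congr wt; lia | lia].
Qed.

(** Attaching a variable 1 to the indices that carry none makes the power of [r]
part of the product of the weights; [N] is a bound that all residues satisfy. *)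
Lemma mpl_mod_path_sum (R : rel nat) (e : seq nat -> nat) s (r : rat) N :
    all (fun x => 0 < x.1)%N s ->
    (forall n, (n < p)%N -> R N n) ->
    (forall ns, size ns = size s ->
       ratr r ^+ e ns
       = \prod_(j < size (map fst s)) (nth (0%N, 1) s j).2 ^+ nth 0%N ns j) ->
  mpl_mod R e (map fst s) r p = path_sum p R (map wt s) N.
Proof.
move=> s_gt0 RN eE.
rewrite -(@path_sum_tuple _ _ R _ N (size (map fst s))); last by rewrite !size_map.
rewrite /mpl_mod big_mkcondr /=.
apply: eq_big => [n | n _]; first by case: n => -[|i ns] //= _; rewrite RN.
have sz : size [seq val i | i <- n] = size s by rewrite size_map size_tuple size_map.
have tnthE j : val (tnth n j) = nth 0%N [seq val i | i <- n] j.
  by rewrite (tnth_nth (tnth n j)) (nth_map (tnth n j)) // size_tuple.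
have ltj (j : 'I_(size (map fst s))) : (j < size s)%N.
  by rewrite -(size_map fst).
have wtE (j : 'I_(size (map fst s))) :
    nth (fun=> 0) (map wt s) j (val (tnth n j))
    = (nth (0%N, 1) s j).2 ^+ nth 0%N [seq val i | i <- n] j
       / (val (tnth n j))%:R ^+ nth 0%N (map fst s) j.
  by rewrite (nth_map (0%N, 1)) // /wt -tnthE (nth_map (0%N, 1)).
under [RHS]eq_bigr do rewrite wtE.
rewrite eE // -prodf_div; case: ifPn => // /allPn[_ /mapP[i ni ->]].
rewrite -leqNgt leqn0 => /eqP i0.
have /tnthP[j ji] := ni.
rewrite prodf_div [X in _ / X](bigD1 j) //= -ji i0.
by rewrite (nth_map (0%N, 1)) // expr0n gtn_eqF ?(all_nthP _ s_gt0) //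
  mul0r invr0 mulr0.
Qed.
End Weights.

(** * Reduction of rationals modulo a prime *)

Section Reduction.

Variable p : nat.
Implicit Types (q r : rat) (x y : 'F_p).

(** [q] is p-integral with residue [x].  As a relation, this is stable under field
operations without any side condition on denominators. *)
Definition reduces q x :=
  exists a b : int,
    [/\ b%:~R != 0 :> 'F_p, q * b%:~R = a%:~R & x = a%:~R / b%:~R].

Lemma reduces_int (z : int) : reduces z%:~R z%:~R.
Proof. by exists z, 1; rewrite !mulr1 divr1 oner_eq0. Qed.

Lemma reduces_nat n : reduces n%:R n%:R.
Proof. exact: (reduces_int n). Qed.

Lemma reducesN q x : reduces q x -> reduces (- q) (- x).
Proof.
case=> a [b [b0 qb ->]]; exists (- a), b; split=> //.
  by rewrite mulNr qb rmorphN.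
by rewrite rmorphN mulNr.
Qed.

Lemma reducesD q r x y : reduces q x -> reduces r y -> reduces (q + r) (x + y).
Proof.
case=> a [b [b0 qb ->]] [c [d [d0 rd ->]]].
exists (a * d + c * b), (b * d); split; first by rewrite rmorphM mulf_neq0.
  by rewrite rmorphD !rmorphM /= -qb -rd; ring.
by rewrite rmorphD !rmorphM /= addf_div.
Qed.

Lemma reducesM q r x y : reduces q x -> reduces r y -> reduces (q * r) (x * y).
Proof.
case=> a [b [b0 qb ->]] [c [d [d0 rd ->]]].
exists (a * c), (b * d); split; first by rewrite rmorphM mulf_neq0.
  by rewrite !rmorphM /= -qb -rd; ring.
by rewrite !rmorphM /= mulf_div.
Qed.

Lemma reducesV q x : reduces q x -> x != 0 -> reduces q^-1 x^-1.
Proof.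
case=> a [b [b0 qb ->]] x0; exists b, a; split; last by rewrite invf_div.
  by apply: contraNneq x0 => ->; rewrite mul0r.
have b0' : b%:~R != 0 :> rat.
  by rewrite intr_eq0; apply: contraNneq b0 => ->.
have [q0 | q0] := eqVneq q 0; last by rewrite -qb mulKf.
move: qb x0; rewrite q0 mul0r => /esym/eqP; rewrite intr_eq0 => /eqP->.
by rewrite mul0r eqxx.
Qed.

Lemma reducesX q x n : reduces q x -> reduces (q ^+ n) (x ^+ n).
Proof.
move=> qx; elim: n => [|n IHn]; first exact: (reduces_nat 1).
by rewrite !exprS; exact: reducesM.
Qed.

Lemma reduces_sum n (f : 'I_n -> rat) (g : 'I_n -> 'F_p) :
  (forall i, reduces (f i) (g i)) -> reduces (\sum_i f i) (\sum_i g i).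
Proof.
move=> fg; apply: (big_ind2 reduces) => //; first exact: (reduces_nat 0).
by move=> *; exact: reducesD.
Qed.

(** If q = a / b and p does not divide b, then it does not divide the reduced
denominator either, since that one divides b. *)
Lemma reduces_ratr q x : reduces q x -> ratr q = x.
Proof.
case=> a [b [b0 qb ->]]; rewrite /ratr.
have /eqP num_den : a * denq q == numq q * b.
  by rewrite -(inj_eq (@intr_inj rat)) !rmorphM /= -qb numqE; apply/eqP; ring.
have den_b : (denq q %| b)%Z.
  rewrite -(@Gauss_dvdzr _ (numq q)); first by rewrite -num_den dvdz_mull.
  by rewrite coprimezE coprime_sym coprime_num_den.
have dq0 : (denq q)%:~R != 0 :> 'F_p.
  by case/dvdzP: den_b b0 => c ->; rewrite rmorphM mulf_eq0 negb_or => /andP[].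
by apply/eqP; rewrite eqr_div // -!rmorphM /= num_den.
Qed.

End Reduction.

(** * Truncated generating series of the Bernoulli numbers *)

Section BernoulliModP.

Variable p : nat.
Hypothesis p_pr : prime p.
Local Notation F := 'F_p.

Lemma Fp_fact_neq0 n : (n < p)%N -> n`!%:R != 0 :> F.
Proof.
elim: n => [|n IHn] ltnp; first exact: oner_neq0.
by rewrite factS natrM mulf_neq0 ?IHn ?Fp_natr_neq0 ?ltnp //; exact: ltnW.
Qed.

Lemma reduces_invf n : (n < p)%N -> reduces n`!%:R^-1 (n`!%:R^-1 : F).
Proof. by move=> ltnp; apply: reducesV (reduces_nat _ _) (Fp_fact_neq0 _). Qed.

Definition bern i : F := ratr (bernoulli i / i`!%:R).

(** The recurrence for B_i / i! only divides by factorials up to (i + 1)!, and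
i + 1 < p. *)
Lemma reduces_bern i : (i < p.-1)%N -> reduces (bernoulli i / i`!%:R) (bern i).
Proof.
suff ex_red : (i < p.-1)%N -> exists x : F, reduces (bernoulli i / i`!%:R) x.
  by move=> /ex_red[x Bix]; rewrite /bern (reduces_ratr Bix).
elim/ltn_ind: i => i IHi lti.
have IH j : (j < i)%N -> reduces (bernoulli j / j`!%:R) (bern j).
  move=> ltji; have [|x Bx] := IHi j ltji; first exact: ltn_trans lti.
  by rewrite /bern (reduces_ratr Bx).
exists (i`!%:R^-1 - \sum_(j < i) bern j / (i.+1 - j)`!%:R).
have -> : bernoulli i / i`!%:R
    = i`!%:R^-1 - \sum_(j < i) bernoulli j / j`!%:R / (i.+1 - j)`!%:R :> rat.
  have /= := bernoulli_genfun i.+1.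
  rewrite !big_ord_recr /= subnn subSnn /= mulr0 addr0 divr1 => genfun.
  rewrite -[X in _ = X - _]genfun addrAC -sumrB big1 ?add0r // => j _.
  by rewrite subSn ?subrr // ltnW.
have invf n : (n < p)%N -> reduces n`!%:R^-1 (n`!%:R^-1 : F) by exact: reduces_invf.
apply: reducesD; first by apply: invf; lia.
apply: reducesN; apply: reduces_sum => j; apply: reducesM; first exact: IH.
by apply: invf; have := ltn_ord j; lia.
Qed.

Lemma ratr_bernoulli i : (i < p.-1)%N -> ratr (bernoulli i) = i`!%:R * bern i :> F.
Proof.
move=> lti; apply: reduces_ratr; have -> : bernoulli i = i`!%:R * (bernoulli i / i`!%:R).
  by rewrite mulrC divfK // pnatr_eq0 -lt0n fact_gt0.
by apply: reducesM; [exact: reduces_nat | exact: reduces_bern].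
Qed.

Lemma bern_genfun n : (0 < n < p)%N ->
  \sum_(i < n) bern i / (n - i)`!%:R = n.-1`!%:R^-1.
Proof.
case: n => // n /= ltnp.
have red_r : reduces (coef_texp n.+1) (n`!%:R^-1 : F).
  by apply: reduces_invf; lia.
rewrite -(reduces_ratr red_r) -bernoulli_genfun.
apply/esym/reduces_ratr; rewrite big_ord_recr /= subnn mulr0 addr0.
apply: reduces_sum => i; apply: reducesM; first by apply: reduces_bern; have := ltn_ord i; lia.
have -> : (n.+1 - i)%N = (n - i).+1 by have := ltn_ord i; lia.
by apply: reduces_invf; lia.
Qed.

(** The truncations of e^(c t) and of c t e^(c t) / (e^(c t) - 1); the second stops
below degree p - 1 because p divides the denominator of B_(p-1). *)
Definition exp_trunc c : {poly F} := \poly_(i < p) (c ^+ i / i`!%:R).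
Definition ber_trunc c : {poly F} := \poly_(i < p.-1) (c ^+ i * bern i).

Lemma dvd_polyXnP (n : nat) (f g : {poly F}) :
  (forall i, (i < n)%N -> f`_i = g`_i) <-> ('X^n %| f - g)%R.
Proof.
split=> [eqfg | /dvdpP[q fgq] i ltin].
  rewrite -(poly_take_drop n (f - g)) (_ : take_poly n _ = 0) ?add0r ?dvdp_mull //.
  apply/polyP=> i; rewrite coef_take_poly coef0; case: ifP => // ltin.
  by rewrite coefB eqfg // subrr.
by apply/eqP; rewrite -subr_eq0 -coefB fgq coefMXn ltin.
Qed.

Lemma exp_truncD c d : 'X^p %| exp_trunc c * exp_trunc d - exp_trunc (c + d).
Proof.
apply/dvd_polyXnP => i ltip; rewrite coefM coef_poly ltip addrC exprDn mulr_suml.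
apply: eq_bigr => j _; have leji : (j <= i)%N by rewrite -ltnS.
rewrite !coef_poly !(leq_ltn_trans _ ltip) ?leq_subr //.
have fact0 n : (n <= i)%N -> n`!%:R != 0 :> F.
  by move=> leni; apply: Fp_fact_neq0; exact: leq_ltn_trans ltip.
rewrite -(bin_fact leji) !natrM -mulr_natr.
field.
rewrite !fact0 ?leq_subr //=.
by have := fact0 i (leqnn i); rewrite -(bin_fact leji) natrM mulf_eq0 negb_or => /andP[].
Qed.

Lemma exp_trunc0 : exp_trunc 0 = 1.
Proof.
apply/polyP=> i; rewrite coef_poly coef1 expr0n.
case: i => [|i]; rewrite ?prime_gt0 ?divr1 //= mul0r.
by case: ifP.
Qed.

(** The coefficient of degree p - 1 of the first factor does not matter modulo
'X^p since the second factor has no constant term. *)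
Lemma ber_truncE c :
  'X^p %| ber_trunc c * (exp_trunc c - 1) - c *: ('X * exp_trunc c).
Proof.
apply/dvd_polyXnP => n ltnp; rewrite coefM coefZ coefXM.
have e0 : (exp_trunc c - 1)`_0 = 0.
  by rewrite coefB coef1 coef_poly prime_gt0 // divr1 subrr.
rewrite big_ord_recr /= subnn e0 mulr0 addr0.
case: n ltnp => [|n] ltnp; first by rewrite big_ord0 mulr0.
rewrite /= coef_poly (ltnW ltnp) mulrA -exprS -(bern_genfun (n := n.+1)) ?ltnp // mulr_sumr.
apply: eq_bigr => i _; have lti := ltn_ord i.
rewrite coefB coef1 !coef_poly.
have -> : (n.+1 - i == 0)%N = false by lia.
rewrite subr0.
have -> : (i < p.-1)%N by lia.
have -> : (n.+1 - i < p)%N by lia.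
have -> : c ^+ n.+1 = c ^+ i * c ^+ (n.+1 - i) by rewrite -exprD subnKC // ltnW.
by ring.
Qed.

End BernoulliModP.

(** * Power sums modulo a prime *)

Section PowerSums.

Variable p : nat.
Hypothesis p_pr : prime p.
Local Notation F := 'F_p.
Local Notation E := (@exp_trunc p).
Local Notation B := (@ber_trunc p).

(** Multiply the geometric sum (e^t - 1) (e^t + ... + e^(N t)) = e^t (e^(N t) - 1)
by the Bernoulli series. *)
Lemma faulhaber_trunc N :
  'X^p %| B 1 * (E N%:R - 1) - 'X * \sum_(n < N) E n.+1%:R.
Proof.
elim: N => [|N IHN].
  by rewrite exp_trunc0 // subrr mulr0 big_ord0 mulr0 subr0 dvdp0.
rewrite big_ord_recr /=.
have -> : B 1 * (E N.+1%:R - 1) - 'X * (\sum_(n < N) E n.+1%:R + E N.+1%:R)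
  = (B 1 * (E N%:R - 1) - 'X * \sum_(n < N) E n.+1%:R)
    + E N%:R * (B 1 * (E 1 - 1) - 1 *: ('X * E 1))
    + ('X - B 1) * (E N%:R * E 1 - E (N%:R + 1)).
  by rewrite -natr1 scale1r; ring.
by apply: dvdp_add; [apply: dvdp_add => // |]; apply: dvdp_mull;
  [exact: ber_truncE | exact: exp_truncD].
Qed.

Lemma faulhaber e N : (e.+1 < p)%N ->
  \sum_(n < N) n.+1%:R ^+ e
  = e`!%:R * \sum_(i < e.+1) bern p i * (N%:R ^+ (e.+1 - i) / (e.+1 - i)`!%:R).
Proof.
move=> lte; have e_neq0 := Fp_fact_neq0 p_pr (ltnW lte).
have /dvd_polyXnP/(_ e.+1 lte) := faulhaber_trunc N.
rewrite coefXM coef_sum coefM big_ord_recr /= subnn coefB coef1 [(E _)`_0]coef_poly.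
rewrite prime_gt0 // divr1 subrr mulr0 addr0 => sumE.
transitivity (e`!%:R * \sum_(n < N) (E n.+1%:R)`_e).
  rewrite mulr_sumr; apply: eq_bigr => n _.
  by rewrite coef_poly (ltnW lte) mulrC divfK.
rewrite -sumE; congr (_ * _); apply: eq_bigr => i _; have lti := ltn_ord i.
rewrite coefB coef1 !coef_poly expr1n mul1r.
have -> : (e.+1 - i == 0)%N = false by lia.
have -> : (i < p.-1)%N by lia.
have -> : (e.+1 - i < p)%N by lia.
by rewrite subr0.
Qed.

Lemma sum_shift_Fp (f : nat -> F) : f 0%N = 0 -> f p = 0 ->
  \sum_(n < p) f n.+1 = \sum_(n < p) f n.
Proof.
move=> f0 fp.
transitivity (\sum_(n < p.+1) f n); first by rewrite big_ord_recl f0 add0r.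
by rewrite big_ord_recr /= fp addr0.
Qed.

(** Faulhaber's polynomial has no constant term, and p is 0 in the prime field. *)
Lemma sum_powers_lt e : (0 < e < p.-1)%N -> \sum_(n < p) (n%:R : F) ^+ e = 0.
Proof.
move=> /andP[e_gt0 lte].
rewrite -(sum_shift_Fp (f := fun n => n%:R ^+ e)).
- rewrite faulhaber; last by lia.
  rewrite big1 ?mulr0 // => i _; rewrite Fp_natr // expr0n.
  have -> : (e.+1 - i == 0)%N = false by have := ltn_ord i; lia.
  by rewrite mul0r mulr0.
- by rewrite expr0n gtn_eqF.
- by rewrite Fp_natr // expr0n gtn_eqF.
Qed.

Lemma Fp_expX (x : F) : x != 0 -> x ^+ p.-1 = 1.
Proof.
move=> x0; apply: (mulfI x0); rewrite -exprS mulr1 prednK ?prime_gt0 //.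
exact: Fp_exp.
Qed.

Lemma sum_powers_pred : \sum_(n < p) (n%:R : F) ^+ p.-1 = -1.
Proof.
have p_gt1 := prime_gt1 p_pr.
have -> : \sum_(n < p) (n%:R : F) ^+ p.-1 = \sum_(n < p.-1) 1.
  have recl N (f : nat -> F) : (0 < N)%N ->
    \sum_(n < N) f n = f 0%N + \sum_(n < N.-1) f n.+1.
    by case: N => // N _; exact: big_ord_recl.
  rewrite (recl p (fun n => n%:R ^+ p.-1)) ?prime_gt0 // expr0n.
  have -> : (p.-1 == 0)%N = false by lia.
  rewrite add0r; apply: eq_bigr => n _.
  rewrite Fp_expX // Fp_natr_neq0 //.
  by have := ltn_ord n; lia.
rewrite sumr_const card_ord -subn1 natrB ?prime_gt0 // Fp_natr //.
by rewrite sub0r.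
Qed.

Lemma sum_powers_gt e : (p.-1 < e < (p.-1).*2)%N -> \sum_(n < p) (n%:R : F) ^+ e = 0.
Proof.
move=> lte; rewrite -[RHS](@sum_powers_lt (e - p.-1)); last by lia.
apply: eq_bigr => n _; have [-> | n0] := eqVneq (n%:R : F) 0.
  by rewrite !expr0n; congr (nat_of_bool _)%:R; lia.
have -> : e = ((e - p.-1) + p.-1)%N by lia.
by rewrite exprD Fp_expX // mulr1 addnK.
Qed.

Lemma Fp_invX (x : F) k : (0 < k < p.-1)%N -> x ^- k = x ^+ (p.-1 - k).
Proof.
move=> ltk; have [-> | x0] := eqVneq x 0.
  rewrite !expr0n.
  have -> : (k == 0)%N = false by lia.
  have -> : (p.-1 - k == 0)%N = false by lia.
  by rewrite invr0.
apply: (mulfI (expf_neq0 k x0)); rewrite divff ?expf_neq0 //.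
by rewrite -exprD subnKC ?Fp_expX //; lia.
Qed.

(** As p is odd, the alternating sum [A] of the e^(n t), 1 <= n <= p, satisfies
A (1 + e^t) = -2 e^t.  Hence t A and the combination of Bernoulli series, each
multiplied by e^(2t) - 1, both equal -2 t e^t (e^t - 1).  Cancelling
e^(2t) - 1, which has valuation 1, costs one degree. *)
Lemma alternating_trunc : odd p ->
  'X^(p.-1) %| B 1 *+ 2 - B 2%:R *+ 2 - 'X * \sum_(n < p) (-1) ^+ n.+1 * E n.+1%:R.
Proof.
move=> p_odd; set A := \sum_(n < p) _; set D := _ - _.
have AE1 : A * (1 + E 1) + E 1 *+ 2
   = \sum_(n < p) (-1) ^+ n.+1 * (E n.+1%:R * E 1 - E (n.+1%:R + 1)).
  have tel N : \sum_(n < N) (-1) ^+ n.+1 * E n.+1%:R * (1 + E 1)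
     = \sum_(n < N) (-1) ^+ n.+1 * (E n.+1%:R * E 1 - E (n.+1%:R + 1))
       - E 1 - (-1) ^+ N.+1 * E N.+1%:R.
    elim: N => [|N IHN]; first by rewrite !big_ord0 expr1 mulr1n; ring.
    by rewrite !big_ord_recr /= IHN -[N.+2%:R]natr1 !exprS; ring.
  rewrite mulr_suml tel exprS -signr_odd p_odd -natr1 Fp_natr // add0r.
  by ring.
have AE1_dvd : 'X^p %| A * (1 + E 1) + E 1 *+ 2.
  by rewrite AE1; apply: (big_ind (fun q => 'X^p %| q)) => [|q r|n _];
    [exact: dvdp0 | exact: dvdp_add | rewrite dvdp_mull // exp_truncD].
have E11 : 'X^p %| E 1 * E 1 - E 2%:R by rewrite -[2%:R]/(1 + 1 : F) exp_truncD.
have XDV : 'X^p %| (E 2%:R - 1) * D.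
  have -> : (E 2%:R - 1) * D =
      (B 1 * (E 1 - 1) - 1 *: ('X * E 1)) * (1 + E 1) *+ 2
      - (B 2%:R * (E 2%:R - 1) - 2%:R *: ('X * E 2%:R)) *+ 2
      - (A * (1 + E 1) + E 1 *+ 2) * 'X * (E 1 - 1)
      + ('X *+ 4 - B 1 *+ 2 + 'X * A) * (E 1 * E 1 - E 2%:R).
    by rewrite /D scale1r scaler_nat; ring.
  (* Each of the four terms is a multiple of one of the known congruences. *)
  have dvd2 q : 'X^p %| q -> 'X^p %| q *+ 2 by move=> ?; rewrite mulr2n dvdp_add.
  apply: dvdp_add; last by rewrite dvdp_mull.
  apply: dvdp_sub; last by rewrite -mulrA dvdp_mulr.
  by apply: dvdp_sub; apply: dvd2; rewrite ?dvdp_mulr // ber_truncE.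
have p_gt2 : (2 < p)%N by case: p p_pr p_odd => [|[|[|q]]].
have [V E2V V0] : exists2 V, E 2%:R - 1 = 'X * V & V`_0 != 0.
  have : 'X^1 %| E 2%:R - 1.
    apply/dvd_polyXnP => -[|//] _.
    by rewrite coef_poly prime_gt0 // divr1 coef1.
  case/dvdpP=> V E2V; exists V; first by rewrite E2V mulrC.
  have -> : V`_0 = (E 2%:R - 1)`_1 by rewrite E2V expr1 coefMX.
  rewrite coefB coef1 coef_poly prime_gt1 // divr1 subr0.
  by rewrite Fp_natr_neq0.
have Xp : 'X^p = 'X * 'X^(p.-1) :> {poly F} by rewrite -exprS prednK ?prime_gt0.
move: XDV; rewrite E2V -mulrA Xp dvdp_mul2l ?polyX_eq0 // Gauss_dvdpr //.
by rewrite coprimep_expl // coprimep_sym coprimepX rootE horner_coef0.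
Qed.

Lemma alternating_powers e : odd p -> (0 < e)%N -> (e.+1 < p.-1)%N ->
  \sum_(n < p) (-1) ^+ n * n%:R ^+ e
  = e`!%:R * (2%:R - 2%:R ^+ e.+2) * bern p e.+1.
Proof.
move=> p_odd e_gt0 lte; have ltep : (e < p)%N by lia.
have e_neq0 := Fp_fact_neq0 p_pr ltep.
have /dvd_polyXnP/(_ e.+1 lte) := alternating_trunc p_odd.
rewrite coefXM coef_sum coefB !coefMn ![(B _)`__]coef_poly lte /= => UE.
rewrite -(sum_shift_Fp (f := fun n => (-1) ^+ n * n%:R ^+ e)).
- transitivity (e`!%:R * \sum_(n < p) ((-1) ^+ n.+1 * E n.+1%:R)`_e).
    rewrite mulr_sumr; apply: eq_bigr => n _; rewrite -polyC1 -polyCN -polyC_exp.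
    by rewrite coefCM coef_poly ltep; field.
  by rewrite -UE expr1n !exprS; ring.
- by rewrite expr0n gtn_eqF // mulr0.
- by rewrite Fp_natr // expr0n gtn_eqF // mulr0.
Qed.

(** This extends Wilson's theorem, the case j = 0, as p - 1 - j is -(j + 1). *)
Lemma Fp_factM j : (j < p)%N ->
  (p.-1 - j)`!%:R * j`!%:R = (-1) ^+ j.+1 :> F.
Proof.
have p_gt1 := prime_gt1 p_pr.
elim: j => [|j IHj] ltjp.
  rewrite subn0 mulr1 expr1; apply/eqP; rewrite -subr_eq0 opprK natr1.
  by rewrite -(dvdn_pcharf (pchar_Fp p_pr)) -Wilson.
rewrite exprS -IHj; last exact: ltnW.
have -> : (p.-1 - j = (p.-1 - j.+1).+1)%N by lia.
rewrite !factS !natrM.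
have -> : (p.-1 - j.+1).+1%:R = - j.+1%:R :> F.
  apply/eqP; rewrite -subr_eq0 opprK -natrD; have -> : ((p.-1 - j.+1).+1 + j.+1 = p)%N by lia.
  by rewrite Fp_natr.
by ring.
Qed.

(** The truncated multiple harmonic sums, that is, the sums at 1. *)
Definition hsum ks N : F := nsum (map (@wt p) (map (pair^~ 1) ks)) N.

Lemma wtE k t n : wt (k, t) n = t ^+ n * (n%:R : F) ^- k.
Proof. by []. Qed.

Lemma hsum1 k : (0 < k < p.-1)%N -> hsum [:: k] p = 0.
Proof.
move=> ltk; rewrite -[RHS](@sum_powers_lt (p.-1 - k)); last by lia.
by apply: eq_bigr => n _; rewrite mulr1 wtE expr1n mul1r Fp_invX.
Qed.

Lemma alternating_hsum m : odd p -> (1 < m < p.-1)%N ->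
  nsum [:: wt (m, -1)] p
  = (2%:R ^+ 2 / 2%:R ^+ m - 2%:R) / m%:R * ratr (bernoulli (p - m)) :> F.
Proof.
move=> p_odd ltm; rewrite ratr_bernoulli //; last by lia.
transitivity (\sum_(n < p) (-1) ^+ n * (n%:R : F) ^+ (p.-1 - m)).
  by apply: eq_bigr => n _; rewrite mulr1 wtE Fp_invX //; lia.
rewrite alternating_powers //; [|lia|lia].
have -> : (p - m = (p.-1 - m).+1)%N by lia.
rewrite factS natrM.
have m0 : m%:R != 0 :> F by apply: Fp_natr_neq0; lia.
have two0 : 2%:R != 0 :> F by apply: Fp_natr_neq0; lia.
have -> : (p.-1 - m).+1%:R = - m%:R :> F.
  apply/eqP; rewrite -subr_eq0 opprK -natrD; have -> : ((p.-1 - m).+1 + m = p)%N by lia.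
  by rewrite Fp_natr.
have -> : 2%:R ^+ (p.-1 - m).+2 = 2%:R ^+ 2 / 2%:R ^+ m :> F.
  by rewrite -[(p.-1 - m).+2]addn2 exprD -(@Fp_invX 2%:R m) 1?[LHS]mulrC //; lia.
field.
by rewrite m0 expf_neq0.
Qed.

(** The inner sum is a polynomial in the outer index n, by Faulhaber's formula.
Summing over n keeps only the term in which n has exponent p - 1, which is the
one with Bernoulli number of index p - w. *)
Lemma hsum2 k1 k2 : (0 < k1)%N -> (0 < k2)%N -> (k1 + k2 < p.-1)%N ->
  hsum [:: k1; k2] p
  = (-1) ^+ k1 * 'C(k1 + k2, k1)%:R / (k1 + k2)%:R * ratr (bernoulli (p - (k1 + k2))).
Proof.
move=> k1_gt0 k2_gt0 ltw; set w := (k1 + k2)%N.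
have lepw : (w < p.-1)%N by [].
rewrite ratr_bernoulli //; last by lia.
have -> : hsum [:: k1; k2] p
    = \sum_(n < p) n%:R ^+ (p.-1 - k1) * \sum_(m < n) m.+1%:R ^+ (p.-1 - k2).
  (* With B_1 = 1/2, Faulhaber's formula sums up to n included; the diagonal
     that this adds is the single sum of weight w, which vanishes. *)
  have eqS : hsum [:: k1; k2] p + hsum [:: w] p
      = \sum_(n < p) n%:R ^+ (p.-1 - k1) * \sum_(m < n) m.+1%:R ^+ (p.-1 - k2).
    rewrite -big_split /=; apply: eq_bigr => n _.
    rewrite !mulr1 !wtE expr1n !mul1r exprD invfM -mulrDr Fp_invX; last by lia.
    congr (_ * _); rewrite [X in _ + X]Fp_invX; last by lia.
    have zero : (0%:R : F) ^+ (p.-1 - k2) = 0 by rewrite expr0n gtn_eqF //; lia.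
    transitivity (\sum_(m < n.+1) (m%:R : F) ^+ (p.-1 - k2)).
      rewrite big_ord_recr /=; congr (_ + _); apply: eq_bigr => m _.
      by rewrite mulr1 wtE expr1n mul1r Fp_invX //; lia.
    by rewrite big_ord_recl zero add0r.
  by rewrite -eqS hsum1 ?addr0 //; lia.
pose c i : F := bern p i / ((p.-1 - k2).+1 - i)`!%:R.
transitivity ((p.-1 - k2)`!%:R * \sum_(i < (p.-1 - k2).+1)
    c i * \sum_(n < p) (n%:R : F) ^+ ((p.-1 - k1) + ((p.-1 - k2).+1 - i))).
  rewrite mulr_sumr; under [RHS]eq_bigr do rewrite mulrA mulr_sumr.
  rewrite exchange_big /=; apply: eq_bigr => n _; rewrite faulhaber; last by lia.
  rewrite mulrA mulr_sumr; apply: eq_bigr => i _; rewrite exprD /c; ring.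
have ltpw : (p - w < (p.-1 - k2).+1)%N by lia.
rewrite (bigD1 (Ordinal ltpw)) //= [X in _ + X]big1 ?addr0; last first.
  move=> i /negP neq_i; have lti := ltn_ord i.
  have [lt_i | gt_i | eq_i] := ltngtP i (p - w).
  - by rewrite sum_powers_gt ?mulr0 //; lia.
  - by rewrite sum_powers_lt ?mulr0 //; lia.
  - by case: neq_i; apply/eqP/val_inj.
have -> : (p.-1 - k1 + ((p.-1 - k2).+1 - (p - w)) = p.-1)%N by lia.
rewrite sum_powers_pred /c.
have -> : ((p.-1 - k2).+1 - (p - w) = k1)%N by lia.
have fact2 := @Fp_factM k2 ltac:(lia).
have factw := @Fp_factM w.-1 ltac:(lia).
have wE : (p.-1 - w.-1 = p - w)%N by lia.
rewrite wE prednK ?addn_gt0 ?k1_gt0 // in factw.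
have fact0 n : (n < p)%N -> n`!%:R != 0 :> F by exact: Fp_fact_neq0.
have k10 := fact0 k1 ltac:(lia); have k20 := fact0 k2 ltac:(lia).
have pw0 := fact0 (p - w)%N ltac:(lia); have w10 := fact0 w.-1 ltac:(lia).
have w0 : w%:R != 0 :> F by apply: Fp_natr_neq0; lia.
have binw : 'C(w, k1)%:R * (k1`!%:R * k2`!%:R) = w%:R * w.-1`!%:R :> F.
  rewrite -!natrM -[w in RHS]prednK ?addn_gt0 ?k1_gt0 // -factS prednK ?addn_gt0 ?k1_gt0 //.
  by rewrite -(@bin_fact w k1) ?leq_addr // addKn.
have -> : (p.-1 - k2)`!%:R = (-1) ^+ k2.+1 / k2`!%:R :> F by rewrite -fact2 mulfK.
have -> : (p - w)`!%:R = (-1) ^+ k1 * (-1) ^+ k2 / w.-1`!%:R :> F.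
  by rewrite -exprD -factw mulfK.
have -> : 'C(w, k1)%:R = w%:R * w.-1`!%:R / (k1`!%:R * k2`!%:R) :> F.
  by rewrite -binw mulfK // mulf_neq0.
have sq : ((-1) ^+ k1 : F) * (-1) ^+ k1 = 1 by rewrite -expr2 sqrr_sign.
rewrite exprS -[LHS]mul1r -[X in X * _ = _]sq; field.
by rewrite k10 k20 w10 w0.
Qed.

End PowerSums.

(** * Finite polylogarithms under the substitution of 1 - X for X *)

Section Polylogarithms.

Variable p : nat.
Hypothesis p_pr : prime p.
Local Notation F := 'F_p.
Local Notation hsum := (@hsum p).
Implicit Types (P Q : {poly F}) (k : nat) (ks : seq nat) (h g : nat -> F).

Definition comp1B P := P \Po (1 - 'X).

(** With [h := hsum ks], the generating polynomial of the sums for [k :: ks] with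
the variable on the largest index. *)
Definition Li k h : {poly F} := \poly_(n < p) (h n * n%:R ^- k).

Lemma horner_Li k ks t :
  (Li k (hsum ks)).[t] = nsum (map (@wt p) ((k, t) :: map (pair^~ 1) ks)) p.
Proof.
rewrite horner_poly; apply: eq_bigr => n _.
by rewrite -mulrA mulrC [_ * t ^+ n]mulrC.
Qed.

Lemma horner1_Li k ks : (Li k (hsum ks)).[1] = hsum (k :: ks) p.
Proof. exact: horner_Li. Qed.

Lemma horner0_Li k h : (0 < k)%N -> (Li k h).[0] = 0.
Proof.
by case: k => // k _; rewrite horner_coef0 coef_poly expr0n invr0 mulr0 if_same.
Qed.

Lemma horner_comp1B P t : (comp1B P).[t] = P.[1 - t].
Proof. by rewrite horner_comp !hornerE. Qed.

Lemma deriv_comp1B P : (comp1B P)^`() = - comp1B P^`().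
Proof. by rewrite deriv_comp derivB derivX derivC sub0r mulrN1. Qed.

Lemma size_oneBX : size (1 - 'X : {poly F}) = 2.
Proof. by rewrite -opprB size_polyN size_XsubC. Qed.

Lemma oneBX_neq0 : 1 - 'X != 0 :> {poly F}.
Proof. by rewrite -size_poly_gt0 size_oneBX. Qed.

Lemma size_comp1B P : size (comp1B P) = size P.
Proof. by rewrite size_comp_poly2 // size_oneBX. Qed.

Lemma size_Li k h : (size (Li k h) <= p)%N.
Proof. exact: size_poly. Qed.

(** In degree less than p, characteristic p does not create new constants. *)
Lemma deriv_eq0_inj P a : (size P <= p)%N -> P^`() = 0 -> P.[a] = 0 -> P = 0.
Proof.
move=> szP dP Pa.
have coefP n : P`_n.+1 = 0.
  have [lenp | ltpn] := ltnP n.+1 p; last by rewrite nth_default // (leq_trans szP).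
  have /polyP/(_ n)/eqP := dP; rewrite coef_deriv coef0 -mulr_natr mulf_eq0.
  by rewrite (negPf (Fp_natr_neq0 _ _)) ?orbF // => /eqP.
have PC : P = (P`_0)%:P by apply/polyP=> -[|n]; rewrite coefC //= coefP.
by move: Pa; rewrite PC hornerC => ->; rewrite polyC0.
Qed.

Lemma eq_poly_deriv (f : {poly F}) P Q a :
    f != 0 -> (size P <= p)%N -> (size Q <= p)%N ->
    f * P^`() = f * Q^`() -> P.[a] = Q.[a] -> P = Q.
Proof.
move=> f0 szP szQ /(mulfI f0) dPQ PQa; apply/eqP; rewrite -subr_eq0; apply/eqP.
apply: (@deriv_eq0_inj _ a).
- by rewrite (leq_trans (size_polyD _ _)) // size_polyN geq_max szP.
- by rewrite derivB dPQ subrr.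
- by rewrite hornerD hornerN PQa subrr.
Qed.

(** The Euler operator multiplies the coefficient of 'X^n by n. *)
Lemma derivX_Li k h : (0 < k)%N -> 'X * (Li k.+1 h)^`() = Li k h.
Proof.
move=> k_gt0; apply/polyP=> -[|n]; rewrite coefXM /=.
  by rewrite -horner_coef0 horner0_Li.
rewrite coef_deriv !coef_poly; case: ifP => [ltnp | _]; last by rewrite mul0rn.
have n0 : n.+1%:R != 0 :> F by apply: Fp_natr_neq0.
by rewrite -[LHS]mulr_natr exprS invfM -mulrA [_ * n.+1%:R]mulrAC mulVf ?mul1r.
Qed.

(** Multiplying by 1 - 'X turns the partial sums h into their increments g, up to
the boundary term in degree p - 1. *)
Lemma deriv1BX_Li h g : h 0%N = 0 -> (forall n, h n.+1 = h n + g n) ->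
  (1 - 'X) * (Li 1 h)^`() = \poly_(n < p) g n - h p *: 'X^(p.-1).
Proof.
move=> h0 hS; have p_gt0 := prime_gt0 p_pr.
have coef_dLi n : ((Li 1 h)^`())`_n = if (n.+1 < p)%N then h n.+1 else 0.
  rewrite coef_deriv coef_poly expr1; case: ifP => [ltnp|_]; last by rewrite mul0rn.
  by rewrite -[LHS]mulr_natr divfK // Fp_natr_neq0.
apply/polyP=> n; rewrite mulrBl mul1r !coefB coefXM !coef_dLi coefZ coefXn coef_poly.
have -> : (if n == 0%N then 0 else if (n.-1.+1 < p)%N then h n.-1.+1 else 0)
          = (if (n < p)%N then h n else 0).
  by case: n => [|n] //=; rewrite p_gt0 h0.
case: (ltngtP n p.-1) => [ltn | gtn | ->].
- have [-> ->] : (n.+1 < p)%N /\ (n < p)%N by lia.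
  by rewrite hS mulr0 subr0 addrAC subrr add0r.
- have [-> ->] : (n.+1 < p)%N = false /\ (n < p)%N = false by lia.
  by rewrite mulr0.
- rewrite prednK // ltnn.
  have -> : h p = h p.-1 + g p.-1 by rewrite -hS prednK.
  by rewrite mulr1 leqnn; ring.
Qed.

Lemma deriv1BX_Li_hsum k ks :
  (1 - 'X) * (Li 1 (hsum (k :: ks)))^`()
  = Li k (hsum ks) - hsum (k :: ks) p *: 'X^(p.-1).
Proof.
rewrite (@deriv1BX_Li _ (fun n => hsum ks n * n%:R ^- k)) //.
  by rewrite /hsum nsum0.
by move=> n; rewrite /hsum /= big_ord_recr /= wtE expr1n mul1r mulrC.
Qed.

Lemma deriv1BX_Li_nil : (1 - 'X) * (Li 1 (hsum [::]))^`() = 1 - 'X^(p.-1).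
Proof.
have -> : Li 1 (hsum [::]) = Li 1 (fun n => (0 < n)%N%:R).
  by apply/polyP=> -[|n]; rewrite !coef_poly // invr0 !mulr0.
rewrite (@deriv1BX_Li _ (fun n => (n == 0)%N%:R)) // => [|n].
  rewrite prime_gt0 // scale1r; congr (_ - _); apply/polyP=> n.
  by rewrite coef_poly coef1; case: n => [|n]; rewrite ?prime_gt0 ?if_same.
by case: n => [|n]; rewrite ?addr0 ?add0r.
Qed.

Lemma oneBX_expp : (1 - 'X) ^+ p = 1 - 'X^p :> {poly F}.
Proof.
have chF : [pchar {poly F}].-nat p.
  by rewrite (eq_pnat _ (pchar_poly _)) pnatE // pchar_Fp.
by rewrite exprDn_pchar // exprNn_pchar // expr1n.
Qed.

Lemma comp1B_oneBX : comp1B (1 - 'X) = 'X.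
Proof. by rewrite /comp1B rmorphB rmorph1 /= comp_polyX; ring. Qed.

Lemma comp1BM P Q : comp1B (P * Q) = comp1B P * comp1B Q.
Proof. exact: rmorphM. Qed.

Lemma deriv1BX_comp1B P : (1 - 'X) * (comp1B P)^`() = - comp1B ('X * P^`()).
Proof. by rewrite deriv_comp1B comp1BM /comp1B comp_polyX mulrN. Qed.

Lemma derivX_comp1B P : 'X * (comp1B P)^`() = - comp1B ((1 - 'X) * P^`()).
Proof. by rewrite deriv_comp1B comp1BM comp1B_oneBX mulrN. Qed.

(** This is the self-duality of the truncated logarithm, which comes from
(1 - X) ^ p = 1 - X ^ p. *)
Lemma deriv1BX_comp1B_Li1 : (1 - 'X) * (comp1B (Li 1 (hsum [::])))^`() = 1 - 'X^(p.-1).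
Proof.
rewrite deriv1BX_comp1B.
have Xp : 'X^p = 'X * 'X^(p.-1) :> {poly F} by rewrite -exprS prednK ?prime_gt0.
suff -> : - comp1B ('X * (Li 1 (hsum [::]))^`()) = 1 - 'X^(p.-1) by [].
apply: (mulfI (negbT (polyX_eq0 F))).
rewrite mulrN -[X in - (X * _)]comp1B_oneBX -comp1BM mulrCA deriv1BX_Li_nil.
rewrite !mulrBr !mulr1 -Xp /comp1B rmorphB rmorphXn /= !comp_polyX oneBX_expp.
by ring.
Qed.

(** Both sides have the same image under (1 - X) d/dX by induction, and vanish at
0.  The boundary term of [deriv1BX_Li_hsum] is the value at 1 of the previous
polynomial, which the induction hypothesis shows to be 0. *)
Lemma Li_ones m : (m.+1 < p.-1)%N ->
  Li 1 (hsum (nseq m 1%N)) = (-1) ^+ m *: comp1B (Li m.+1 (hsum [::])).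
Proof.
elim: m => [|m IHm] ltmp.
  rewrite scale1r; apply: (@eq_poly_deriv (1 - 'X) _ _ 0 oneBX_neq0).
  - exact: size_Li.
  - by rewrite size_comp1B size_Li.
  - by rewrite deriv1BX_comp1B_Li1 deriv1BX_Li_nil.
  - by rewrite horner_comp1B subr0 horner0_Li // horner1_Li hsum1 //; lia.
have IH := IHm (ltnW ltmp).
apply: (@eq_poly_deriv (1 - 'X) _ _ 0 oneBX_neq0).
- exact: size_Li.
- by rewrite (leq_trans (size_scale_leq _ _)) // size_comp1B size_Li.
- rewrite [nseq _ _]/= deriv1BX_Li_hsum IH -horner1_Li IH hornerZ horner_comp1B subrr.
  rewrite horner0_Li // mulr0 scale0r subr0 derivZ -scalerAr deriv1BX_comp1B.
  by rewrite derivX_Li // exprS scalerN mulN1r scaleNr opprK.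
- rewrite hornerZ horner_comp1B subr0 horner0_Li // horner1_Li hsum1 ?mulr0 //; lia.
Qed.

Lemma hsum_ones m : (0 < m < p.-1)%N -> hsum (nseq m 1%N) p = 0.
Proof.
case: m => // m /= ltm; rewrite [nseq _ _]/= -horner1_Li Li_ones //.
by rewrite hornerZ horner_comp1B subrr horner0_Li // mulr0.
Qed.

Definition Li_ones2 a b : {poly F} :=
  Li (head 0%N (ones2 a.+1 b.+1)) (hsum (behead (ones2 a.+1 b.+1))).

Lemma Li_ones2S a b : Li_ones2 a.+1 b = Li 1 (hsum (ones2 a.+1 b.+1)).
Proof. by []. Qed.

(** Apply (1 - X) d/dX, or X d/dX when a = 0, and compare values at 1.  The
constants are the values at 1; each of them, as the boundary term of the next
derivative, then produces one more single sum. *)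
Lemma Li_ones2_duality a b : (a.+1 < p.-1)%N -> (b.+1 < p.-1)%N ->
  Li_ones2 a b = (-1) ^+ (a + b).+1 *: comp1B (Li a.+1 (hsum [:: b.+1]))
            + (hsum (ones2 a.+1 b.+1) p)%:P
            + \sum_(j < a) ((-1) ^+ j * hsum (ones2 (a.-1 - j).+1 b.+1) p)
                             *: comp1B (Li j.+1 (hsum [::])).
Proof.
move=> lta ltb; elim: a lta => [|a IHa] lta.
  rewrite big_ord0 addr0.
  apply: (@eq_poly_deriv 'X _ _ 1 (negbT (polyX_eq0 F))).
  - exact: size_Li.
  - rewrite (leq_trans (size_polyD _ _)) // geq_max (leq_trans (size_scale_leq _ _)).
      by rewrite (leq_trans (size_polyC_leq1 _)) // prime_gt0.
    by rewrite size_comp1B size_Li.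
  - rewrite derivX_Li // Li_ones // derivD derivC addr0 derivZ -scalerAr derivX_comp1B.
    rewrite deriv1BX_Li_hsum hsum1 ?scale0r ?subr0 //.
    by rewrite exprS scalerN mulN1r scaleNr opprK.
  - rewrite hornerD hornerZ horner_comp1B subrr horner0_Li // mulr0 add0r hornerC.
    by rewrite horner1_Li.
have IH := IHa (ltnW lta).
have ones2_cons : ones2 a.+1 b.+1 = head 0%N (ones2 a.+1 b.+1) :: behead (ones2 a.+1 b.+1).
  by case: (a).
apply: (@eq_poly_deriv (1 - 'X) _ _ 1 oneBX_neq0).
- exact: size_Li.
- have size_term c k h : (size (c *: comp1B (Li k h)) <= p)%N.
    by rewrite (leq_trans (size_scale_leq _ _)) // size_comp1B size_Li.
  have sizeD P Q : (size P <= p)%N -> (size Q <= p)%N -> (size (P + Q)%R <= p)%N.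
    by move=> szP szQ; rewrite (leq_trans (size_polyD _ _)) // geq_max szP.
  apply: (sizeD); first apply: (sizeD); first exact: size_term.
    by rewrite (leq_trans (size_polyC_leq1 _)) // prime_gt0.
  by rewrite (leq_trans (size_sum _ _ _)) //; apply/bigmax_leqP.
- rewrite Li_ones2S {1}ones2_cons deriv1BX_Li_hsum -/(Li_ones2 a b) -ones2_cons IH.
  rewrite !derivD derivC addr0 derivZ raddf_sum /= mulrDr -scalerAr deriv1BX_comp1B.
  rewrite derivX_Li // mulr_sumr big_ord_recl /= subn0 mul1r.
  rewrite derivZ -scalerAr deriv1BX_comp1B_Li1.
  rewrite [X in _ = _ + (_ + X)](eq_bigr (fun j : 'I_a =>
      ((-1) ^+ j * hsum (ones2 (a.-1 - j).+1 b.+1) p) *: comp1B (Li j.+1 (hsum [::])))).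
    by rewrite addSn [in RHS]exprS scalerN mulN1r scaleNr opprK scalerBr -!mul_polyC; ring.
  move=> j _; rewrite derivZ -scalerAr deriv1BX_comp1B derivX_Li //.
  rewrite /bump /= add1n exprS mulN1r mulNr scalerN scaleNr opprK.
  by congr ((_ * hsum (ones2 _.+1 b.+1) p) *: _); lia.
- rewrite !hornerD hornerC hornerZ horner_comp1B subrr horner0_Li // mulr0 add0r.
  rewrite horner_sum big1 ?addr0; first by rewrite Li_ones2S horner1_Li.
  by move=> j _; rewrite hornerZ horner_comp1B subrr horner0_Li // mulr0.
Qed.

(** Evaluate [Li_ones2_duality] at 0: the single sums become sums of inverse
powers, which vanish. *)
Lemma hsum_ones2 a b : (a.+1 < p.-1)%N -> (b.+1 < p.-1)%N ->
  hsum (ones2 a.+1 b.+1) p = (-1) ^+ (a + b) * hsum [:: a.+1; b.+1] p.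
Proof.
move=> lta ltb; have := congr1 (horner^~ 0) (Li_ones2_duality lta ltb).
rewrite /= horner0_Li; last by case: (a).
rewrite !hornerD hornerC hornerZ horner_comp1B subr0 horner1_Li horner_sum.
rewrite big1 => [|j _].
  rewrite addr0 exprS mulN1r mulNr addrC => /esym/eqP; rewrite subr_eq0 => /eqP->.
  by [].
rewrite hornerZ horner_comp1B subr0 horner1_Li hsum1 ?mulr0 //.
by have := ltn_ord j; lia.
Qed.

End Polylogarithms.

(** * Sums with the variable on the largest or smallest index *)

Section OneVariable.

Variable p : nat.
Hypothesis p_pr : prime p.
Local Notation F := 'F_p.
Implicit Types (ks : seq nat) (t : F).

(** Indices paired with variables: the pairs (k, 1) carry no variable. *)
Definition at_head ks t : seq (nat * F) :=
  if ks is k :: ks' then (k, t) :: map (pair^~ 1) ks' else [::].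

Definition at_last ks t := rev (at_head (rev ks) t).

Definition Lhead ks t : F := nsum (map (@wt p) (at_head ks t)) p.
Definition Llast_star ks t : F := nsum_star (map (@wt p) (at_last ks t)) p.

Lemma map_fst_at_head ks t : map fst (at_head ks t) = ks.
Proof. by case: ks => //= k ks; rewrite -map_comp map_id. Qed.

Lemma map_fst_at_last ks t : map fst (at_last ks t) = ks.
Proof. by rewrite /at_last map_rev map_fst_at_head revK. Qed.

Lemma at_last_rcons ks k t :
  at_last (rcons ks k) t = rcons (map (pair^~ 1) ks) (k, t).
Proof. by rewrite /at_last rev_rcons /= rev_cons map_rev revK. Qed.

Lemma positive_items ks (s : seq (nat * F)) :
  map fst s = ks -> all (ltn 0) ks -> all (fun x => 0 < x.1)%N s.
Proof. by move=> <-; rewrite all_map. Qed.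

Lemma prod_items_head ks t : ks != [::] ->
  \prod_(x <- at_head ks t) ((-1) ^+ x.1 * x.2) = (-1) ^+ sumn ks * t.
Proof.
case: ks => // k ks _ /=; rewrite big_cons /= big_map /=.
have -> : \prod_(j <- ks) ((-1) ^+ j * 1) = (-1) ^+ sumn ks :> F.
  elim: ks => [|j ks IHks]; first by rewrite big_nil.
  by rewrite big_cons IHks /= exprD mulr1.
by rewrite exprD; ring.
Qed.

Lemma at_headV ks t :
  map (fun x => (x.1, x.2^-1)) (at_head ks t) = at_head ks t^-1.
Proof.
case: ks => //= k ks; rewrite -map_comp; congr (_ :: _).
by apply: eq_map => j /=; rewrite invr1.
Qed.

Lemma at_lastV ks t :
  map (fun x => (x.1, x.2^-1)) (at_last ks t) = at_last ks t^-1.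
Proof. by rewrite /at_last map_rev at_headV. Qed.

Lemma reflect_last ks t : ks != [::] -> all (ltn 0) ks ->
  nsum (map (@wt p) (at_last ks t)) p = (-1) ^+ sumn ks * t * Lhead (rev ks) t^-1.
Proof.
move=> ks0 ks_gt0; rewrite nsum_reflect //; last first.
  by apply: (positive_items (map_fst_at_head _ _)); rewrite all_rev.
rewrite at_headV prod_items_head ?sumn_rev //.
by rewrite -size_eq0 size_rev size_eq0.
Qed.

Lemma reflect_head_star ks t : ks != [::] -> all (ltn 0) ks ->
  nsum_star (map (@wt p) (at_head ks t)) p
  = (-1) ^+ sumn ks * t * Llast_star (rev ks) t^-1.
Proof.
move=> ks0 ks_gt0.
have -> : at_head ks t = rev (at_last (rev ks) t) by rewrite /at_last !revK.
rewrite nsum_star_reflect //; last first.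
  by apply: (positive_items (map_fst_at_last _ _)); rewrite all_rev.
rewrite at_lastV; congr (_ * _).
rewrite (perm_big (at_head ks t)) /=; last by rewrite /at_last revK perm_rev.
exact: prod_items_head.
Qed.

Lemma nth_ones ks j : (nth (0%N, 1) (map (pair^~ 1) ks) j).2 = 1 :> F.
Proof.
have [ltj | lej] := ltnP j (size ks); first by rewrite (nth_map 0%N).
by rewrite nth_default ?size_map.
Qed.

Lemma head_exponent ks t ns : size ns = size (at_head ks t) ->
  t ^+ head 0%N ns = \prod_(j < size (map fst (at_head ks t)))
                       (nth (0%N, 1) (at_head ks t) j).2 ^+ nth 0%N ns j.
Proof.
case: ks => [|k ks] /=; first by move/size0nil->; rewrite big_ord0.
case: ns => // n ns _; rewrite big_ord_recl /= big1 ?mulr1 // => j _.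
by rewrite nth_ones expr1n.
Qed.

Lemma last_exponent ks t ns : size ns = size (at_last ks t) ->
  t ^+ last 0%N ns = \prod_(j < size (map fst (at_last ks t)))
                       (nth (0%N, 1) (at_last ks t) j).2 ^+ nth 0%N ns j.
Proof.
case/lastP: ks => [|ks k] /=; first by move/size0nil->; rewrite big_ord0.
rewrite at_last_rcons map_rcons !size_rcons !size_map.
case/lastP: ns => // ns n; rewrite size_rcons => -[szns]; rewrite last_rcons.
rewrite big_ord_recr /= big1 ?mul1r => [|j _].
  by rewrite !nth_rcons size_map -szns ltnn eqxx.
by rewrite nth_rcons size_map ltn_ord nth_ones expr1n.
Qed.

Lemma mpl_gtn e ks (s : F -> seq (nat * F)) r : all (ltn 0) ks ->
    (forall t, map fst (s t) = ks) ->
    (forall t ns, size ns = size (s t) -> t ^+ e ns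
      = \prod_(j < size (map fst (s t))) (nth (0%N, 1) (s t) j).2 ^+ nth 0%N ns j) ->
  mpl_mod gtn e ks r p = nsum (map (@wt p) (s (ratr r))) p.
Proof.
move=> ks_gt0 sK sE; rewrite -[in LHS](sK (ratr r)).
rewrite (@mpl_mod_path_sum _ _ _ _ _ p) //; first exact: path_sum_gtn.
  exact: positive_items (sK _) ks_gt0.
exact: sE.
Qed.

Lemma mpl_geq e ks (s : F -> seq (nat * F)) r : all (ltn 0) ks ->
    (forall t, map fst (s t) = ks) ->
    (forall t ns, size ns = size (s t) -> t ^+ e ns
      = \prod_(j < size (map fst (s t))) (nth (0%N, 1) (s t) j).2 ^+ nth 0%N ns j) ->
  mpl_mod geq e ks r p = nsum_star (map (@wt p) (s (ratr r))) p.
Proof.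
move=> ks_gt0 sK sE; rewrite -[in LHS](sK (ratr r)); have p_gt0 := prime_gt0 p_pr.
rewrite (@mpl_mod_path_sum _ _ _ _ _ p.-1) //.
- by rewrite path_sum_geq prednK.
- exact: positive_items (sK _) ks_gt0.
- by move=> n ltnp /=; lia.
- exact: sE.
Qed.

Lemma mplE ks r : all (ltn 0) ks ->
  mpl_mod gtn (head 0%N) ks r p = Lhead ks (ratr r).
Proof.
move=> ks_gt0; apply: (@mpl_gtn _ ks (at_head ks)) => //;
  [exact: map_fst_at_head | exact: head_exponent].
Qed.

Lemma tmpl_starE ks r : all (ltn 0) ks ->
  mpl_mod geq (last 0%N) ks r p = Llast_star ks (ratr r).
Proof.
move=> ks_gt0; apply: (@mpl_geq _ ks (at_last ks)) => //;
  [exact: map_fst_at_last | exact: last_exponent].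
Qed.

Lemma tmplE ks r : ks != [::] -> all (ltn 0) ks ->
  mpl_mod gtn (last 0%N) ks r p
  = (-1) ^+ sumn ks * ratr r * Lhead (rev ks) (ratr r)^-1.
Proof.
move=> ks0 ks_gt0; rewrite -reflect_last //.
by apply: (@mpl_gtn _ ks (at_last ks)) => //; [exact: map_fst_at_last | exact: last_exponent].
Qed.

Lemma mpl_starE ks r : ks != [::] -> all (ltn 0) ks ->
  mpl_mod geq (head 0%N) ks r p
  = (-1) ^+ sumn ks * ratr r * Llast_star (rev ks) (ratr r)^-1.
Proof.
move=> ks0 ks_gt0; rewrite -reflect_head_star //.
by apply: (@mpl_geq _ ks (at_head ks)) => //; [exact: map_fst_at_head | exact: head_exponent].
Qed.

Lemma take_at_last ks t i : (i < size ks)%N ->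
  take i (at_last ks t) = map (pair^~ 1) (take i ks).
Proof.
case/lastP: ks => // ks k; rewrite size_rcons ltnS => lei.
by rewrite at_last_rcons -!cats1 !takel_cat ?size_map // map_take.
Qed.

Lemma drop_at_last ks t i : (i < size ks)%N ->
  drop i (at_last ks t) = at_last (drop i ks) t.
Proof.
case/lastP: ks => // ks k; rewrite size_rcons ltnS => lei.
rewrite drop_rcons // !at_last_rcons drop_rcons ?size_map //.
by rewrite map_drop.
Qed.

Lemma size_at_last ks t : size (at_last ks t) = size ks.
Proof. by rewrite -(size_map fst) map_fst_at_last. Qed.

(** In the antipode relation, the terms other than the extreme ones are products
of a strict sum without variable and a shorter weak sum; here they are assumed
to vanish. *)
Lemma Llast_star_antipode ks t : ks != [::] ->
    (forall i, (0 < i < size ks)%N ->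
       hsum p (rev (take i ks)) p * Llast_star (drop i ks) t = 0) ->
  Llast_star ks t = (-1) ^+ (size ks).-1 * Lhead (rev ks) t.
Proof.
move=> ks0 cross0; have ks_gt0 : (0 < size ks)%N by rewrite lt0n size_eq0.
have := @nsum_antipode _ (map (@wt p) (at_last ks t)) p.
rewrite size_map size_at_last => /(_ ks_gt0).
rewrite big_ord_recr /= -[size ks]prednK // big_ord_recl /=.
rewrite big1 => [|i _].
  rewrite take0 drop0 mul1r addr0 prednK // drop_oversize ?size_map ?size_at_last //.
  rewrite take_oversize ?size_map ?size_at_last //= !mul1r mulr1 -map_rev /at_last revK.
  move/eqP; rewrite addr_eq0 => /eqP; rewrite -/(Llast_star ks t) => ->.
  by rewrite -[in LHS](prednK ks_gt0) exprS mulN1r mulNr opprK.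
rewrite /bump /= add1n -map_take -map_drop -map_rev.
have lti : (i.+1 < size ks)%N by have := ltn_ord i; lia.
rewrite take_at_last // drop_at_last // -map_rev -mulrA -/(hsum p _ p).
by rewrite -/(Llast_star _ t) cross0 ?mulr0.
Qed.

End OneVariable.

(** * Values at 2 *)

Section Values.

Variable p : nat.
Hypothesis p_pr : prime p.
Hypothesis p_odd : odd p.
Local Notation F := 'F_p.
Local Notation hsum := (@hsum p).
Local Notation Lhead := (@Lhead p).
Local Notation Llast_star := (@Llast_star p).
Local Notation beta w := (ratr (bernoulli (p - w)) : F).
Local Notation ones m := (nseq m 1%N).

Lemma eq_opp_eq0 (x : F) : x = - x -> x = 0.
Proof.
move/eqP; rewrite -subr_eq0 opprK -mulr2n -mulr_natr mulf_eq0 => /orP[/eqP //|].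
rewrite (negPf (Fp_natr_neq0 p_pr _)) //.
by case: p p_pr p_odd => [|[|[|]]].
Qed.

Lemma alternating_hsum_even m : (0 < m)%N -> ~~ odd m ->
  nsum [:: wt (m, -1 : F)] p = 0.
Proof.
move=> m_gt0 m_even; apply: eq_opp_eq0.
have := @nsum_reflect _ p_pr [:: (m, -1)]; rewrite /= m_gt0 => /(_ isT).
by rewrite big_seq1 /= -signr_odd (negPf m_even) mul1r mulN1r invrN1.
Qed.

Lemma Lhead_ones_horner m t : Lhead (ones m.+1) t = (Li 1 (hsum (ones m))).[t].
Proof. by rewrite horner_Li. Qed.

Lemma Lhead_ones2_horner a b t :
  Lhead (ones2 a.+1 b.+1) t = (Li_ones2 p a b).[t].
Proof. by case: a => [|a]; rewrite horner_Li. Qed.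

Lemma Lhead_ones m : (0 < m < p.-1)%N ->
  Lhead (ones m) 2%:R = (-1) ^+ m.-1 * nsum [:: wt (m, -1)] p.
Proof.
case: m => // m /= ltm; rewrite Lhead_ones_horner Li_ones // hornerZ horner_comp1B.
by rewrite -[X in 1 - X]/(1 + 1) opprD addrA subrr add0r horner_Li.
Qed.

Lemma Lhead_ones_even m : (0 < m < p.-1)%N -> ~~ odd m -> Lhead (ones m) 2%:R = 0.
Proof.
move=> ltm m_even; rewrite Lhead_ones // alternating_hsum_even ?mulr0 //.
by case/andP: ltm.
Qed.

(** For even m both sides vanish, so that the sign of [Lhead_ones] is harmless. *)
Lemma Lhead_ones_value m : (1 < m < p.-1)%N ->
  Lhead (ones m) 2%:R = (2%:R ^+ 2 / 2%:R ^+ m - 2%:R) / m%:R * beta m.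
Proof.
move=> ltm; rewrite -alternating_hsum // Lhead_ones; last by lia.
have [m_odd | m_even] := boolP (odd m).
  by rewrite -signr_odd; case: m m_odd {ltm} => //= m /negPf->; rewrite mul1r.
by rewrite alternating_hsum_even ?mulr0 //; lia.
Qed.

Lemma Llast_star_ones m : (0 < m < p.-1)%N ->
  Llast_star (ones m) 2%:R = (-1) ^+ m.-1 * Lhead (ones m) 2%:R.
Proof.
move=> ltm; rewrite Llast_star_antipode //.
- by rewrite rev_nseq size_nseq.
- by case: m ltm.
move=> i; rewrite size_nseq => lti.
rewrite take_nseq; last by lia.
by rewrite rev_nseq hsum_ones ?mul0r //; lia.
Qed.

Lemma Llast_star_ones_even m : (0 < m < p.-1)%N -> ~~ odd m ->
  Llast_star (ones m) 2%:R = 0.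
Proof. by move=> ltm m_even; rewrite Llast_star_ones // Lhead_ones_even ?mulr0. Qed.

Lemma Llast_star_ones_value m : (1 < m < p.-1)%N ->
  Llast_star (ones m) 2%:R = Lhead (ones m) 2%:R.
Proof.
move=> ltm; have ltm' : (0 < m < p.-1)%N by lia.
rewrite Llast_star_ones //; have [m_odd | m_even] := boolP (odd m).
  by rewrite -signr_odd; case: m m_odd {ltm ltm'} => //= m /negPf->; rewrite mul1r.
by rewrite Lhead_ones_even // mulr0.
Qed.

(** By reflection the double sum is symmetric in its indices, and by the stuffle
product its symmetrization is a combination of vanishing single sums. *)
Lemma hsum2_even k1 k2 : (0 < k1)%N -> (0 < k2)%N -> (k1 + k2 < p.-1)%N ->
  ~~ odd (k1 + k2) -> hsum [:: k1; k2] p = 0.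
Proof.
move=> k1_gt0 k2_gt0 ltw w_even; apply: eq_opp_eq0.
have sym : hsum [:: k1; k2] p = hsum [:: k2; k1] p.
  have s_gt0 : all (fun x => 0 < x.1)%N [:: (k2, 1 : F); (k1, 1)].
    by rewrite /= k1_gt0 k2_gt0.
  have := nsum_reflect p_pr s_gt0; rewrite -[rev _]/[:: (k1, 1); (k2, 1)].
  rewrite !big_cons big_nil /= !mulr1 -exprD invr1 addnC -signr_odd (negPf w_even).
  by rewrite mul1r.
apply/eqP; rewrite -subr_eq0 opprK {2}sym.
have := nsum_stuffle (@wt p (k1, 1)) (@wt p (k2, 1)) p.
have -> : \sum_(n < p) @wt p (k1, 1) n = 0.
  rewrite -[RHS](@hsum1 _ p_pr k1); last by lia.
  by apply: eq_bigr => n _; rewrite /= mulr1.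
rewrite mul0r => stuffle; apply/eqP; rewrite -[RHS]stuffle -[LHS]addr0; congr (_ + _).
rewrite -[LHS](@hsum1 _ p_pr (k1 + k2)); last by lia.
by apply: eq_bigr => n _; rewrite mulr1 !wtE !expr1n !mul1r exprD invfM.
Qed.

Lemma hsum_ones2_even a b : (a.+1 + b.+1 < p.-1)%N -> ~~ odd (a + b) ->
  hsum (ones2 a.+1 b.+1) p = 0.
Proof.
move=> ltw w_even; rewrite hsum_ones2 //; [|lia|lia].
by rewrite hsum2_even ?mulr0 // addSnnS !addnS /= negbK.
Qed.

(** As w and p are odd, reflection fixes the sign pattern and reverses the order of
the indices, so the stuffle product gives twice the double sum. *)
Lemma alternating_hsum2 a b : (a.+1 + b.+1 < p.-1)%N -> odd (a + b) ->
  nsum (map (@wt p) [:: (a.+1, -1); (b.+1, 1)]) p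
  = - (nsum [:: wt ((a.+1 + b.+1)%N, -1 : F)] p) / 2%:R.
Proof.
move=> ltw w_odd; set D := nsum _ _.
have sym : nsum (map (@wt p) [:: (b.+1, 1); (a.+1, -1)]) p = D.
  have := @nsum_reflect _ p_pr [:: (b.+1, 1); (a.+1, -1)] isT.
  rewrite -[rev _]/[:: (a.+1, -1); (b.+1, 1)] -/D !big_cons big_nil /=.
  rewrite !mulr1 mulrA -exprD invr1 invrN1 -signr_odd !addSn addnS /= negbK addnC w_odd.
  by rewrite mulrNN !mulr1 mul1r => ->.
have two0 : 2%:R != 0 :> F.
  by apply: Fp_natr_neq0 => //; case: p p_pr p_odd => [|[|[|]]].
have := nsum_stuffle (@wt p (a.+1, -1)) (@wt p (b.+1, 1)) p.
have -> : \sum_(n < p) @wt p (b.+1, 1) n = 0.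
  rewrite -[RHS](@hsum1 _ p_pr b.+1); last by lia.
  by apply: eq_bigr => n _; rewrite /= mulr1.
have -> : nsum [:: wt (b.+1, 1); wt (a.+1, -1)] p = D by rewrite -sym.
have -> : \sum_(n < p) @wt p (a.+1, -1) n * wt (b.+1, 1) n
    = nsum [:: wt ((a.+1 + b.+1)%N, -1)] p.
  by apply: eq_bigr => n _; rewrite mulr1 !wtE expr1n mul1r -mulrA exprD invfM.
rewrite mulr0 -/D -mulr2n => /eqP; rewrite addr_eq0 => /eqP <-.
by rewrite -[D *+ 2]mulr_natr mulfK.
Qed.

(** Each cross term of [Li_ones2_duality] at 2 is a product of a sum of weight
w - (j + 1) and an alternating single sum of weight j + 1.  One of these weights
is even, and the factor of even weight vanishes. *)
Lemma Lhead_ones2 a b : (a.+1 + b.+1 < p.-1)%N -> odd (a + b) ->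
  Lhead (ones2 a.+1 b.+1) 2%:R
  = - (nsum [:: wt ((a.+1 + b.+1)%N, -1 : F)] p) / 2%:R + hsum (ones2 a.+1 b.+1) p.
Proof.
move=> ltw w_odd; rewrite Lhead_ones2_horner Li_ones2_duality //; [|lia|lia].
have two1 : 1 - 2%:R = -1 :> F by rewrite -[2%:R]/(1 + 1) opprD addrA subrr add0r.
rewrite !hornerD hornerC horner_sum big1 => [|j _].
  rewrite addr0 hornerZ horner_comp1B two1 horner_Li -alternating_hsum2 //.
  by rewrite -signr_odd /= w_odd mul1r.
rewrite hornerZ horner_comp1B two1 horner_Li; have ltj := ltn_ord j.
have [j_odd | j_even] := boolP (odd j.+1); last first.
  by rewrite [X in _ * X]alternating_hsum_even ?mulr0.
by rewrite hsum_ones2_even ?mulr0 ?mul0r //; lia.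
Qed.

Lemma rev_ones2 k1 k2 : rev (ones2 k1 k2) = ones2 k2 k1.
Proof. by rewrite /ones2 rev_cat rev_cons !rev_nseq cat_rcons. Qed.

(** Cutting the index before or right at the end of the first run of 1 leaves a
vanishing harmonic sum over 1, ..., 1.  Cutting it later leaves two factors
whose weights add up to w, and the one of even weight vanishes. *)
Lemma Llast_star_ones2 a b : (a.+1 + b.+1 < p.-1)%N -> odd (a + b) ->
  Llast_star (ones2 a.+1 b.+1) 2%:R = - Lhead (ones2 b.+1 a.+1) 2%:R.
Proof.
move=> ltw w_odd.
have sz : size (ones2 a.+1 b.+1) = (a + b).+1.
  by rewrite size_cat /= !size_nseq addnS.
rewrite Llast_star_antipode //; first by rewrite sz rev_ones2 -signr_odd w_odd mulN1r.
  by rewrite -size_eq0 sz.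
move=> i; rewrite sz => lti; rewrite take_cat drop_cat size_nseq /=.
have [lt_ia | le_ai] := ltnP i a.
  by rewrite take_nseq ?rev_nseq ?hsum_ones ?mul0r //; lia.
have [eq_ia | neq_ia] := eqVneq i a.
  by rewrite eq_ia subnn take0 cats0 rev_nseq hsum_ones ?mul0r //; lia.
have [c Dc] : exists c, (i - a = c.+1)%N by exists (i - a).-1; lia.
rewrite Dc /= take_nseq; last by lia.
rewrite -[_ ++ _]/(ones2 a.+1 c.+1) rev_ones2 drop_nseq.
have [m_odd | m_even] := boolP (odd (b - c)).
  by rewrite hsum_ones2_even ?mul0r //; lia.
by rewrite Llast_star_ones_even ?mulr0 //; lia.
Qed.

Lemma Lhead_ones2_value k1 k2 : (0 < k1)%N -> (0 < k2)%N ->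
    (k1 + k2 < p.-1)%N -> odd (k1 + k2) ->
  Lhead (ones2 k1 k2) 2%:R
  = (1 - 2%:R / 2%:R ^+ (k1 + k2) - (-1) ^+ k1 * 'C(k1 + k2, k1)%:R)
    / (k1 + k2)%:R * beta (k1 + k2).
Proof.
case: k1 k2 => // a [] // b _ _ ltw w_odd.
have ab_odd : odd (a + b) by lia.
rewrite Lhead_ones2 // alternating_hsum //; last by lia.
rewrite hsum_ones2 ?hsum2 //; [|lia|lia].
rewrite -signr_odd ab_odd expr1.
have two0 : 2%:R != 0 :> F.
  by apply: Fp_natr_neq0 => //; case: p p_pr p_odd => [|[|[|]]].
have w0 : (a.+1 + b.+1)%:R != 0 :> F by apply: Fp_natr_neq0 => //; lia.
move: w0; set w := (a.+1 + b.+1)%N => w0.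
have two_w0 : 2%:R ^+ w != 0 :> F by rewrite expf_neq0.
move: (2%:R ^+ w) two_w0 (w%:R) w0 ('C(w, _)%:R) ((-1) ^+ _) (ratr _) => x x0 y y0 c s B.
by field; rewrite x0 y0.
Qed.

Lemma Llast_star_ones2_value k1 k2 : (0 < k1)%N -> (0 < k2)%N ->
    (k1 + k2 < p.-1)%N -> odd (k1 + k2) ->
  Llast_star (ones2 k1 k2) 2%:R
  = (- (1 - 2%:R / 2%:R ^+ (k1 + k2)) - (-1) ^+ k1 * 'C(k1 + k2, k1)%:R)
    / (k1 + k2)%:R * beta (k1 + k2).
Proof.
move=> k1_gt0 k2_gt0 ltw w_odd.
have -> : Llast_star (ones2 k1 k2) 2%:R = - Lhead (ones2 k2 k1) 2%:R.
  case: k1 k2 k1_gt0 k2_gt0 ltw w_odd => // a [] // b _ _ ltw w_odd.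
  by rewrite Llast_star_ones2 //; lia.
rewrite Lhead_ones2_value //; [|by rewrite addnC|by rewrite addnC].
rewrite [(k2 + k1)%N]addnC.
have -> : 'C(k1 + k2, k2) = 'C(k1 + k2, k1) by rewrite -(bin_sub (leq_addl _ _)) addnK.
have -> : (-1) ^+ k2 = - (-1) ^+ k1 :> F.
  rewrite -signr_odd -[in RHS]signr_odd; move: w_odd; rewrite oddD.
  by case: (odd k1); case: (odd k2) => // _; rewrite ?opprK.
by ring.
Qed.

End Values.

(** * Rational coefficients and the values in the ring of classes *)

Section Coefficients.

Variables (p w : nat).
Hypotheses (p_pr : prime p) (p_odd : odd p) (w_bounds : (1 < w < p)%N).
Local Notation F := 'F_p.

Lemma Fp_two_neq0 : 2%:R != 0 :> F.
Proof. by apply: Fp_natr_neq0 => //; case: p p_pr p_odd => [|[|[|]]]. Qed.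

Lemma Fp_w_neq0 : w%:R != 0 :> F.
Proof. by apply: Fp_natr_neq0 => //; lia. Qed.

Lemma ratr_half : ratr (1 / 2%:R) = 2%:R^-1 :> F.
Proof.
apply: reduces_ratr; rewrite div1r.
exact: reducesV (reduces_nat _ 2) Fp_two_neq0.
Qed.

Lemma reducesB q r (x y : F) : reduces q x -> reduces r y -> reduces (q - r) (x - y).
Proof. by move=> qx ry; apply: reducesD => //; exact: reducesN. Qed.

Lemma reduces_div_nat q (x : F) n : n%:R != 0 :> F ->
  reduces q x -> reduces (q / n%:R) (x / n%:R).
Proof. by move=> n0 qx; apply: reducesM => //; apply: reducesV => //; exact: reduces_nat. Qed.

Lemma reduces_div_exp2 q (x : F) n :
  reduces q x -> reduces (q / 2%:R ^+ n) (x / 2%:R ^+ n).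
Proof.
move=> qx; apply: reducesM => //; apply: reducesV; last by rewrite expf_neq0 ?Fp_two_neq0.
by apply: reducesX; exact: reduces_nat.
Qed.

Lemma ratr_coef_ones :
  ratr ((1 - 2%:R ^+ (w - 1)) / 2%:R ^+ (w - 2) / w%:R)
  = (2%:R ^+ 2 / 2%:R ^+ w - 2%:R) / w%:R :> F.
Proof.
transitivity ((1 - 2%:R ^+ (w - 1)) / 2%:R ^+ (w - 2) / w%:R : F).
  apply/reduces_ratr/reduces_div_nat; first exact: Fp_w_neq0.
  apply/reduces_div_exp2/reducesB; first exact: (reduces_nat _ 1).
  by apply: reducesX; exact: reduces_nat.
congr (_ / _); case: w w_bounds => [|[|n]] // _; rewrite !subSS !subn0 !exprS.
have n0 : 2%:R ^+ n != 0 :> F by rewrite expf_neq0 ?Fp_two_neq0.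
have := Fp_two_neq0; move: n0; move: (2%:R ^+ n) => x x0 two0.
by field; rewrite x0 two0.
Qed.

Lemma reduces_defect :
  reduces ((2%:R ^+ (w - 1) - 1) / 2%:R ^+ (w - 1)) (1 - 2%:R / 2%:R ^+ w : F).
Proof.
have -> : 1 - 2%:R / 2%:R ^+ w = (2%:R ^+ (w - 1) - 1) / 2%:R ^+ (w - 1) :> F.
  case: w w_bounds => [|n] // _; rewrite subn1 /= exprS.
  have n0 : 2%:R ^+ n != 0 :> F by rewrite expf_neq0 ?Fp_two_neq0.
  have := Fp_two_neq0; move: n0; move: (2%:R ^+ n) => x x0 two0.
  by field; rewrite x0 two0.
apply: reduces_div_exp2; apply: reducesB; last exact: (reduces_nat _ 1).
by apply: reducesX; exact: reduces_nat.
Qed.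

Lemma reduces_defectN :
  reduces ((1 - 2%:R ^+ (w - 1)) / 2%:R ^+ (w - 1)) (- (1 - 2%:R / 2%:R ^+ w) : F).
Proof. by rewrite -opprB mulNr; apply: reducesN; exact: reduces_defect. Qed.

Lemma ratr_coef_ones_half :
  ratr ((2%:R ^+ (w - 1) - 1) / 2%:R ^+ (w - 1) / w%:R)
  = (1 - 2%:R / 2%:R ^+ w) / w%:R :> F.
Proof.
by apply/reduces_ratr/reduces_div_nat; [exact: Fp_w_neq0 | exact: reduces_defect].
Qed.

Lemma reduces_sign_bin k : reduces ((-1) ^+ k * 'C(w, k)%:R) ((-1) ^+ k * 'C(w, k)%:R : F).
Proof.
apply: reducesM; last exact: reduces_nat.
by apply: reducesX; apply: reducesN; exact: (reduces_nat _ 1).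
Qed.

Lemma ratr_coef_ones2 k (c : rat) (x : F) : reduces c x ->
  ratr ((c - (-1) ^+ k * 'C(w, k)%:R) / w%:R)
  = (x - (-1) ^+ k * 'C(w, k)%:R) / w%:R :> F.
Proof.
move=> cx; apply/reduces_ratr/reduces_div_nat; first exact: Fp_w_neq0.
by apply: reducesB => //; exact: reduces_sign_bin.
Qed.

Lemma ratr_coef_ones2_half k (c : rat) (x : F) : reduces c x ->
  ratr (1 / 2%:R * (c - (-1) ^+ k * 'C(w, k)%:R) / w%:R)
  = 2%:R^-1 * (x - (-1) ^+ k * 'C(w, k)%:R) / w%:R :> F.
Proof.
move=> cx; apply/reduces_ratr/reduces_div_nat; first exact: Fp_w_neq0.
apply: reducesM; last by apply: reducesB => //; exact: reduces_sign_bin.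
rewrite div1r; exact: reducesV (reduces_nat _ 2) Fp_two_neq0.
Qed.

End Coefficients.

(** A single bound makes p odd and all weights less than p - 1. *)
Lemma classA_large N (f g : prodFp) :
    (forall p : primeT, (N.+2 < val p)%N -> odd (val p) -> f p = g p) ->
  classA f = classA g.
Proof.
move=> fg; apply/classAP; exists N.+3 => p ltNp; apply: fg => //.
by case: (even_prime (valP p)) => // p2; rewrite p2 in ltNp.
Qed.

Lemma ones2_gt0 k1 k2 : all (ltn 0) (ones2 k1 k2).
Proof. by rewrite all_cat /= !all_nseq !orbT. Qed.

Lemma sumn_ones2 k1 k2 : (0 < k1)%N -> (0 < k2)%N -> sumn (ones2 k1 k2) = (k1 + k2)%N.
Proof. by move=> ? ?; rewrite sumn_cat /= !sumn_nseq !mul1n; lia. Qed.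

Lemma ones2_neq_nil k1 k2 : ones2 k1 k2 != [::].
Proof. by rewrite /ones2; case: nseq. Qed.

Lemma sign_Lhead_ones (p : nat) m : prime p -> odd p -> (1 < m < p.-1)%N ->
  (-1) ^+ m * Lhead (nseq m 1%N) 2%:R = - Lhead (nseq m 1%N) 2%:R :> 'F_p.
Proof.
move=> p_pr p_odd ltm; have [m_odd | m_even] := boolP (odd m).
  by rewrite -signr_odd m_odd mulN1r.
by rewrite Lhead_ones_even ?mulr0 ?oppr0 //; lia.
Qed.

Theorem proposition4p3 (m k1 k2 : nat) (hm : (1 < m)%N)
    (hk1 : (0 < k1)%N) (hk2 : (0 < k2)%N) (hw : odd (k1 + k2)) :
  let w := (k1 + k2)%N in
  (mplA (nseq m 1%N) 2 = tmplA_star (nseq m 1%N) 2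
   /\ tmplA_star (nseq m 1%N) 2
      = ((1 - 2 ^+ (m - 1)) / 2 ^+ (m - 2) / m%:R : rat) *: bernoulliA m)
  /\ (tmplA (nseq m 1%N) (1 / 2) = mplA_star (nseq m 1%N) (1 / 2)
      /\ mplA_star (nseq m 1%N) (1 / 2)
         = ((2 ^+ (m - 1) - 1) / 2 ^+ (m - 1) / m%:R : rat) *: bernoulliA m)
  /\ mplA (ones2 k1 k2) 2
     = (((2 ^+ (w - 1) - 1) / 2 ^+ (w - 1) - (-1) ^+ k1 * 'C(w, k1)%:R)
          / w%:R : rat) *: bernoulliA w
  /\ tmplA_star (ones2 k1 k2) 2
     = (((1 - 2 ^+ (w - 1)) / 2 ^+ (w - 1) - (-1) ^+ k1 * 'C(w, k1)%:R)
          / w%:R : rat) *: bernoulliA w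
  /\ tmplA (ones2 k1 k2) (1 / 2)
     = (1 / 2 * ((1 - 2 ^+ (w - 1)) / 2 ^+ (w - 1) - (-1) ^+ k1 * 'C(w, k1)%:R)
          / w%:R : rat) *: bernoulliA w
  /\ mplA_star (ones2 k1 k2) (1 / 2)
     = (1 / 2 * ((2 ^+ (w - 1) - 1) / 2 ^+ (w - 1) - (-1) ^+ k1 * 'C(w, k1)%:R)
          / w%:R : rat) *: bernoulliA w.
Proof.
move=> w.
have ones_gt0 n : all (ltn 0) (nseq n 1%N) by rewrite all_nseq orbT.
have ones_nil : nseq m 1%N != [::] by case: m hm.
have bin_sym : 'C(w, k2) = 'C(w, k1) by rewrite -(bin_sub (leq_addl _ _)) addnK.
have sgn_sym R : (-1) ^+ k2 = - (-1) ^+ k1 :> (R : pzRingType).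
  rewrite -signr_odd -[in RHS]signr_odd; move: hw; rewrite oddD.
  by case: (odd k1); case: (odd k2) => // _; rewrite ?opprK.
have w_odd_sgn R : (-1) ^+ w = -1 :> (R : pzRingType) by rewrite -signr_odd hw.
rewrite /mplA /tmplA /mplA_star /tmplA_star /bernoulliA !classAZ.
split; last split; last split; last split; last split.
- split; apply: (classA_large (N := m)) => p ltmp p_odd;
    rewrite ?mplE ?tmpl_starE ?(valP p) // ratr_nat;
    rewrite Llast_star_ones_value ?(valP p) //; try lia.
  rewrite Lhead_ones_value ?(valP p) //; last by lia.
  by rewrite ratr_coef_ones ?(valP p) //; lia.
- split; apply: (classA_large (N := m)) => p ltmp p_odd; have p_pr := valP p;
    rewrite ?tmplE ?mpl_starE // ratr_half // invrK rev_nseq sumn_nseq mul1n;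
    rewrite Llast_star_ones_value //; try lia.
  rewrite mulrAC sign_Lhead_ones //; last by lia.
  rewrite Lhead_ones_value //; last by lia.
  rewrite ratr_coef_ones_half //; last by lia.
  by have := Fp_two_neq0 p_pr p_odd => two0; field; rewrite expf_neq0 // Fp_natr_neq0 //; lia.
- apply: (classA_large (N := w)) => p ltwp p_odd; have p_pr := valP p.
  rewrite mplE ?ones2_gt0 // ratr_nat Lhead_ones2_value //; last by lia.
  by rewrite (ratr_coef_ones2 p_pr p_odd _ _ (reduces_defect p_pr p_odd _)) //; lia.
- apply: (classA_large (N := w)) => p ltwp p_odd; have p_pr := valP p.
  rewrite tmpl_starE ?ones2_gt0 // ratr_nat (Llast_star_ones2_value p_pr) //; last by lia.
  by rewrite (ratr_coef_ones2 p_pr p_odd _ _ (reduces_defectN p_pr p_odd _)) //; lia.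
- apply: (classA_large (N := w)) => p ltwp p_odd; have p_pr := valP p.
  rewrite tmplE ?ones2_gt0 ?ones2_neq_nil // ratr_half // invrK.
  rewrite sumn_ones2 // rev_ones2 // Lhead_ones2_value //; [|lia|lia].
  rewrite (ratr_coef_ones2_half p_pr p_odd _ _ (reduces_defectN p_pr p_odd _)) //; [|lia|lia].
  by rewrite [(k2 + k1)%N]addnC -/w bin_sym sgn_sym w_odd_sgn; ring.
- apply: (classA_large (N := w)) => p ltwp p_odd; have p_pr := valP p.
  rewrite mpl_starE ?ones2_gt0 ?ones2_neq_nil // ratr_half // invrK.
  rewrite sumn_ones2 // rev_ones2 // (Llast_star_ones2_value p_pr) //; [|lia|lia].
  rewrite (ratr_coef_ones2_half p_pr p_odd _ _ (reduces_defect p_pr p_odd _)) //; [|lia|lia].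
  by rewrite [(k2 + k1)%N]addnC -/w bin_sym sgn_sym w_odd_sgn; ring.
Qed.
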